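(* For every étale-finite Heyting algebra $H$ there is an elementary topos $\mathcal{E}$, namely $\mathcal{E} := \mathbf{EsaEt}(\mathrm{Spec}(H))$, such that the lattice $\mathrm{Sub}_{\mathcal{E}}(1)$ of subobjects of the terminal object of $\mathcal{E}$ is isomorphic to $H$.
   Context: Étale-finite Heyting algebras. Let $H_0$ be a finite Heyting algebra. A Heyting homomorphism $f\colon H_0\to H$ satisfies Jibladze's law if $\bigvee_{x_0\in H_0}(x\leftrightarrow f(x_0))=1$ for every $x\in H$. A Heyting algebra $H$ is étale-finite if there are a finite Heyting algebra $H_0$ and a homomorphism $f\colon H_0\to H$ satisfying Jibladze's law. Priestley and Esakia spaces. An upset of a poset is an upward-closed subset; ${\downarrow}S$ denotes the downward closure of $S$. An ordered space is a poset equipped with a topology. A Priestley space is a compact ordered space $X$ such that whenever $x\nleq y$ there is a clopen upset $U$ with $x\in U$, $y\notin U$. An Esakia space is a Priestley space in which ${\downarrow}W$ is clopen for every clopen $W$. For a Heyting algebra $H$, $\mathrm{Spec}(H)$ is the dual Esakia space: the set of prime filters of $H$, ordered by inclusion, with the topology generated by the sets $\{F : a\in F\}$ and their complements, $a\in H$. Spectral local homeomorphisms. The spectral topology on a Priestley space is the topology consisting of all open upsets. A spectral local homeomorphism $f\colon Y\to X$ between Priestley spaces is a function that is a local homeomorphism with respect to the spectral topologies. The category $\mathbf{EsaEt}(X)$. For an Esakia space $X$, $\mathbf{EsaEt}(X)$ is the slice over $X$ of the category of Esakia spaces and spectral local homeomorphisms: objects are spectral local homeomorphisms $Y\to X$ with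 $Y$ an Esakia space, and morphisms from $Y_1\to X$ to $Y_2\to X$ are spectral local homeomorphisms $Y_1\to Y_2$ commuting with the maps to $X$. *)

(* Defs.v *)
From HB Require Import structures.
From mathcomp Require Import all_boot all_order.
From mathcomp Require Import all_classical topology.

Set Implicit Arguments.
Unset Strict Implicit.
Unset Printing Implicit Defensive.

Import Order.TTheory.
Local Open Scope order_scope.
Local Open Scope classical_set_scope.

HB.mixin Record TBLattice_isHeyting d T of Order.TBLattice d T := {
  himp : T -> T -> T;
  himpP : forall x y z : T, (Order.meet x y <= z) = (x <= himp y z)
}.

#[short(type="heytingType")]
HB.structure Definition Heyting d :=
  { T of Order.TBLattice d T & TBLattice_isHeyting d T }.

#[short(type="finHeytingType")]
HB.structure Definition FinHeyting d := { T of Heyting d T & Finite T }.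

Definition hiff d (H : heytingType d) (x y : H) : H :=
  Order.meet (himp x y) (himp y x).

Definition jibladze d0 (H0 : finHeytingType d0) d (H : heytingType d)
    (f : H0 -> H) : Prop :=
  forall x : H, \join_(x0 : H0) hiff x (f x0) = \top.

Definition etale_finite d (H : heytingType d) : Prop :=
  exists (d0 : Order.disp_t) (H0 : finHeytingType d0)
    (f : {tblmorphism H0 -> H}),
    {morph f : x y / himp x y} /\ jibladze f.

Section OrderedSpaces.
Variables (d : Order.disp_t) (X : POrderedTopological.type d).

Definition upset (U : set X) : Prop := forall x y : X, x <= y -> U x -> U y.

Definition downclosure (S : set X) : set X :=
  [set x | exists2 s, S s & x <= s].

Definition priestley : Prop :=
  compact [set: X] /\
  forall x y : X, ~ x <= y -> exists U, [/\ clopen U, upset U, U x & ~ U y].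

Definition esakia : Prop :=
  priestley /\ forall W : set X, clopen W -> clopen (downclosure W).

End OrderedSpaces.

(* A copy of the carrier of X, topologized by the open upsets of X. *)
Definition spectral d (X : POrderedTopological.type d) : Type := X.

Section SpectralTopology.
Variables (d : Order.disp_t) (X : POrderedTopological.type d).

Definition open_upset (U : set X) : Prop := open U /\ upset U.

Let open_upsetT : open_upset setT.
Proof. by split=> //; exact: openT. Qed.

Let open_upsetI : setI_closed open_upset.
Proof.
move=> A B [oA uA] [oB uB]; split; first exact: openI.
by move=> x y xy [Ax Bx]; split; [exact: uA Ax|exact: uB Bx].
Qed.

Let open_upset_bigU (I : Type) (f : I -> set X) :
  (forall i, open_upset (f i)) -> open_upset (\bigcup_i f i).
Proof.
move=> of_; split; first by apply: bigcup_open => i _; exact: (of_ i).1.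
by move=> x y xy [i _ fx]; exists i => //; exact: (of_ i).2 fx.
Qed.

HB.instance Definition _ := Choice.on (spectral X).
HB.instance Definition _ := @isOpenTopological.Build (spectral X)
  open_upset open_upsetT open_upsetI open_upset_bigU.

Lemma open_spectralE (U : set (spectral X)) : open U = open_upset U.
Proof. by []. Qed.

End SpectralTopology.

Section LocalHomeo.

(* f restricts to a homeomorphism from A onto its image, for the subspace
   topologies. *)
Definition homeo_on (S T : topologicalType) (A : set S) (f : S -> T) : Prop :=
  {within A, continuous f} /\
  exists2 g : T -> S, {within f @` A, continuous g} &
    forall x, A x -> g (f x) = x.

Definition local_homeo (S T : topologicalType) (f : S -> T) : Prop :=
  forall x : S, exists U : set S,
    [/\ open U, U x, open (f @` U) & homeo_on U f].

Lemma local_homeo_id (S : topologicalType) : local_homeo (@id S).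
Proof.
move=> x; exists setT; split=> //; first exact: openT.
  by rewrite image_id; exact: openT.
split; first by apply: continuous_subspaceT => ?; exact: cvg_id.
by exists id => //; apply: continuous_subspaceT => ?; exact: cvg_id.
Qed.

Let open_within (S T : topologicalType) (A : set S) (f : S -> T) (V : set T) :
  open A -> {within A, continuous f} -> open V -> open (A `&` f @^-1` V).
Proof.
move=> oA cf oV; rewrite openE => x [Ax Vfx].
have {}cf : {in A, continuous f} by rewrite -continuous_open_subspace.
apply: filterI; first exact: open_nbhs_nbhs.
by apply: (cf x); [exact: mem_set|exact: open_nbhs_nbhs].
Qed.

Lemma local_homeo_comp (S T U : topologicalType) (f : S -> T) (g : T -> U) :
  local_homeo f -> local_homeo g -> local_homeo (g \o f).
Proof.
move=> lf lg x.
have [A [oA Ax ofA [cf [f' cf' ff']]]] := lf x.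
have [B [oB Bfx ogB [cg [g' cg' gg']]]] := lg (f x).
pose W := A `&` f @^-1` B.
have oW : open W by exact: open_within.
have fWE : f @` W = f @` A `&` B.
  apply/seteqP; split; first by move=> _ [y [Ay By] <-]; split=> //; exists y.
  by move=> _ [[y Ay <-] By]; exists y.
have ofW : open (f @` W) by rewrite fWE; exact: openI.
have gfWE : (g \o f) @` W = g @` B `&` g' @^-1` (f @` W).
  apply/seteqP; split.
    move=> _ [y [Ay By] <-]; split; first by exists (f y).
    by rewrite /preimage /= gg' //; exists y.
  move=> _ [[t Bt <-]]; rewrite /preimage /= gg' // => -[y Wy fyt].
  by exists y => //=; rewrite fyt.
have ogfW : open ((g \o f) @` W) by rewrite gfWE; exact: open_within.
have cf_ : {in A, continuous f} by rewrite -continuous_open_subspace.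
have cg_ : {in B, continuous g} by rewrite -continuous_open_subspace.
have cf'_ : {in f @` A, continuous f'} by rewrite -continuous_open_subspace.
have cg'_ : {in g @` B, continuous g'} by rewrite -continuous_open_subspace.
exists W; split=> //; split.
  rewrite continuous_open_subspace // => y /set_mem [Ay By].
  apply: continuous_comp; first by apply: cf_; exact: mem_set.
  by apply: cg_; exact: mem_set.
exists (f' \o g'); last by move=> y [Ay By]; rewrite /= gg' ?ff'.
rewrite continuous_open_subspace // => u /set_mem.
rewrite gfWE => -[gBu [y [Ay By] yu]].
apply: continuous_comp; first by apply: cg'_; exact: mem_set.
by apply: cf'_; apply: mem_set; rewrite -yu; exists y.
Qed.

End LocalHomeo.

Section Filters.
Variables (d : Order.disp_t) (H : heytingType d).

Definition lattice_filter (F : set H) : Prop :=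
  [/\ F \top, forall a b : H, a <= b -> F a -> F b
    & forall a b : H, F a -> F b -> F (Order.meet a b)].

Definition prime_filter (F : set H) : Prop :=
  [/\ lattice_filter F, ~ F \bot
    & forall a b : H, F (Order.join a b) -> F a \/ F b].

Lemma himp_filter (F : set H) (a : H) :
  lattice_filter F -> lattice_filter [set x | F (himp a x)].
Proof.
move=> [F1 Fup FI]; split=> /=.
- by apply: Fup F1; rewrite -himpP lex1.
- move=> x y xy; apply: Fup; rewrite -himpP (le_trans _ xy) //.
  by rewrite himpP.
- move=> x y Fx Fy; apply: Fup (FI _ _ Fx Fy).
  by rewrite -himpP lexI; apply/andP; split; rewrite himpP ?leIl ?leIr.
Qed.

Lemma prime_filter_extension (F : set H) (b : H) :
  lattice_filter F -> ~ F b -> exists G, [/\ prime_filter G, F `<=` G & ~ G b].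
Proof.
move=> filF nFb.
pose P := [set Y : set H | lattice_filter (F `|` Y) /\ ~ (F `|` Y) b].
have [C CP Ctot|Y [[filG nGb] maxY]] := @Zorn_bigcup H P.
  split; last first.
    by case=> // -[Y CY Yb]; apply: (CP _ CY).2; right.
  split.
  - by left; case: filF.
  - move=> x y xy [Fx|[Y CY Yx]].
      by left; case: filF => _ Fup _; exact: Fup Fx.
    have [[_ Yup _] _] := CP _ CY.
    by case: (Yup _ _ xy (or_intror Yx)); [left|right; exists Y].
  - have key Y x y : C Y -> (F `|` Y) x -> (F `|` Y) y ->
        (F `|` \bigcup_(X in C) X) (Order.meet x y).
      move=> CY Yx Yy; have [[_ _ YI] _] := CP _ CY.
      by case: (YI _ _ Yx Yy); [left|right; exists Y].
    move=> x y [Fx|[Y CY Yx]] [Fy|[Z CZ Zy]].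
    + by left; case: filF => _ _ FI; exact: FI.
    + by apply: (key Z) => //; [left|right].
    + by apply: (key Y) => //; [right|left].
    + have [YZ|ZY] := Ctot _ _ CY CZ.
        by apply: (key Z) => //; right=> //; exact: YZ.
      by apply: (key Y) => //; right=> //; exact: ZY.
set G := F `|` Y in filG nGb.
have FG : F `<=` G by move=> x; left.
have max x : ~ G x -> G (himp x b).
  move=> nGx; apply: contrapT => nGxb.
  have GZ : G `<=` [set z | G (himp x z)].
    move=> z Gz /=; case: filG => _ Gup _; apply: Gup Gz.
    by rewrite -himpP leIl.
  have FZ : F `|` [set z | G (himp x z)] = [set z | G (himp x z)].
    by apply/setUidPr => z /FG /GZ.
  apply: (maxY [set z | G (himp x z)]); last first.
    by split; rewrite FZ //; exact: himp_filter.
  rewrite properEneq; split; last by move=> z Yz; apply: GZ; right.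
  apply/eqP => YE; apply: nGx; right; rewrite YE /=.
  by case: filG => G1 Gup _; apply: Gup G1; rewrite -himpP leIr.
exists G; split=> //; split=> //.
  by case: filG => _ Gup _ G0; apply: nGb; exact: Gup G0.
move=> x y Gxy; apply: contrapT => /not_orP [/max Gx /max Gy].
apply: nGb; case: filG => _ Gup GI.
apply: Gup (GI _ _ Gxy (GI _ _ Gx Gy)).
rewrite himpP leUx; apply/andP.
by split; rewrite -himpP meetC himpP ?leIl ?leIr.
Qed.

End Filters.

Record spec d (H : heytingType d) : Type := Spec {
  spec_set :> set H;
  spec_prime : prime_filter spec_set
}.

Fact spec_display : Order.disp_t. Proof. exact: Order.Disp tt tt. Qed.

Section Spec.
Variables (d : Order.disp_t) (H : heytingType d).
Implicit Types (F G : spec H) (a b : H).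

Lemma spec_inj : injective (@spec_set d H).
Proof.
move=> [F Fp] [G Gp] /= FG; rewrite FG in Fp *; congr Spec.
exact: Prop_irrelevance.
Qed.

Definition spec_le F G : bool := `[< spec_set F `<=` spec_set G >].

Let spec_le_refl : reflexive spec_le.
Proof. by move=> F; exact/asboolP. Qed.

Let spec_le_anti : antisymmetric spec_le.
Proof.
by move=> F G /andP[/asboolP FG /asboolP GF]; apply: spec_inj; exact/seteqP.
Qed.

Let spec_le_trans : transitive spec_le.
Proof.
move=> G F K /asboolP FG /asboolP GK; apply/asboolP.
exact: subset_trans FG GK.
Qed.

Definition spec_basic (a : H) : set (spec H) := [set F | spec_set F a].

Definition spec_subbase : set (set (spec H)) :=
  [set A | exists a : H, A = spec_basic a \/ A = ~` spec_basic a].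

HB.instance Definition _ := gen_eqMixin (spec H).
HB.instance Definition _ := gen_choiceMixin (spec H).
HB.instance Definition _ := @Order.Le_isPOrder.Build spec_display (spec H)
  spec_le spec_le_refl spec_le_anti spec_le_trans.
HB.instance Definition _ := @isSubBaseTopological.Build (spec H)
  (set (spec H)) spec_subbase id.

Lemma spec_leE F G : (F <= G) = `[< spec_set F `<=` spec_set G >].
Proof. by []. Qed.

Lemma spec_subbase_open (A : set (spec H)) : spec_subbase A -> open A.
Proof.
move=> sA; exists [set A]; last by rewrite bigcup_set1.
by move=> _ ->; exact: finI_from1 sA.
Qed.

Lemma spec_basic_clopen a : clopen (spec_basic a).
Proof.
split; first by apply: spec_subbase_open; exists a; left.
by rewrite -openC; apply: spec_subbase_open; exists a; right.
Qed.

Lemma spec_basic_upset a : upset (spec_basic a).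
Proof. by move=> F G /asboolP FG; exact: FG. Qed.

Lemma spec_basicI a b :
  spec_basic a `&` spec_basic b = spec_basic (Order.meet a b).
Proof.
apply/seteqP; split=> F; case: (spec_prime F) => -[_ Fup FI] _ _.
  by case; exact: FI.
by move=> Fab; split; apply: Fup Fab; rewrite ?leIl ?leIr.
Qed.

Lemma spec_basicU a b :
  spec_basic a `|` spec_basic b = spec_basic (Order.join a b).
Proof.
apply/seteqP; split=> F; case: (spec_prime F) => -[_ Fup FI] _ FU.
  by case; apply: Fup; rewrite ?leUl ?leUr.
exact: FU.
Qed.

Lemma spec_basic0 : spec_basic \bot = set0.
Proof. by apply/seteqP; split=> // F F0; case: (spec_prime F). Qed.

Lemma spec_basic1 : spec_basic \top = setT.
Proof. by apply/seteqP; split=> // F _; case: (spec_prime F) => -[]. Qed.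

Lemma spec_nbhsP F (W : set (spec H)) : nbhs F W ->
  exists a b, (spec_basic a `\` spec_basic b) F /\
    spec_basic a `\` spec_basic b `<=` W.
Proof.
rewrite nbhsE => -[B [oB BF] BW].
suff [a [b [Fab abB]]] : exists a b, (spec_basic a `\` spec_basic b) F /\
    spec_basic a `\` spec_basic b `<=` B.
  by exists a, b; split=> //; exact: subset_trans BW.
case: oB BF => D' sD' <- -[A D'A AF]; have [E sE AE] := sD' _ D'A.
pose s : seq (set (spec H)) := finmap.enum_fset E.
have {}AE : A = [set G | forall B, B \in s -> B G] by rewrite -AE.
have sP C : C \in s -> spec_subbase C /\ C F.
  by move=> Cs; split; [exact: set_mem (sE _ Cs)|move: AF; rewrite AE; apply].
suff [a [b [Fab abA]]] : exists a b, (spec_basic a `\` spec_basic b) F /\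
    spec_basic a `\` spec_basic b `<=` [set G | forall B, B \in s -> B G].
  by exists a, b; split=> // G /abA GA; exists A => //; rewrite AE.
elim: s sP {AE} => [_|A0 s IH sP].
  exists \top, \bot; rewrite spec_basic0 spec_basic1; split=> //.
  by split.
have [|a [b [[Fa Fb] abs]]] := IH.
  by move=> C Cs; apply: sP; rewrite inE Cs orbT.
have [[c [|] A0E] A0F] := sP A0 (mem_head _ _).
- exists (Order.meet c a), b; split.
    by split=> //; rewrite -spec_basicI; split=> //; rewrite -A0E.
  rewrite -spec_basicI => G [[Gc Ga] Gb] C; rewrite inE => /orP [/eqP -> //|].
    by rewrite A0E.
  by apply: abs.
- exists a, (Order.join c b); split.
    split=> //; rewrite -spec_basicU => -[Fc|//].
    by move: A0F; rewrite A0E; exact.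
  rewrite -spec_basicU => G [Ga /not_orP [Gc Gb]] C.
  rewrite inE => /orP [/eqP -> //|]; first by rewrite A0E.
  by apply: abs.
Qed.

Lemma spec_compact : compact [set: spec H].
Proof.
rewrite compact_ultra => U UU _.
have Uup : forall A B : set (spec H), A `<=` B -> U A -> U B.
  by move=> A B AB; exact: filterS.
have Pp : prime_filter [set a | U (spec_basic a)].
  split; first split=> /=.
  - by rewrite spec_basic1; exact: filterT.
  - move=> a b ab; apply: Uup => F; case: (spec_prime F) => -[_ Fup _] _ _.
    exact: Fup.
  - by move=> a b Ua Ub; rewrite -spec_basicI; exact: filterI.
  - by rewrite /= spec_basic0; exact: filter_not_empty.
  - move=> a b /=; rewrite -spec_basicU => Uab.
    have [|Ua] := in_ultra_setVsetC (spec_basic a) UU; first by left.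
    right; apply: Uup (filterI Uab Ua).
    by move=> F [[]].
exists (Spec Pp); split=> // W /spec_nbhsP [a [b [[Ua Ub] abW]]].
apply: Uup abW _; apply: filterI => //.
by have [|] := in_ultra_setVsetC (spec_basic b) UU.
Qed.

Lemma spec_downclosure a b :
  downclosure (spec_basic a `\` spec_basic b) = ~` spec_basic (himp a b).
Proof.
apply/seteqP; split=> F.
  case=> G [Ga Gb] /asboolP FG Fab; apply: Gb.
  case: (spec_prime G) => -[_ Gup GI] _ _.
  by apply: Gup (GI _ _ (FG _ Fab) Ga); rewrite himpP.
move=> Fab; case: (spec_prime F) => filF _ _.
have [G [Gp FG Gb]] := prime_filter_extension (himp_filter a filF) Fab.
exists (Spec Gp).
  split=> //; apply: FG => /=.
  by case: filF => F1 Fup _; apply: Fup F1; rewrite -himpP leIr.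
apply/asboolP => /= x Fx; apply: FG => /=.
by case: filF => _ Fup _; apply: Fup Fx; rewrite -himpP leIl.
Qed.

Lemma spec_esakia : esakia (spec H).
Proof.
split; first split; first exact: spec_compact.
  move=> F G FG; have /existsNP [a /not_implyP [Fa Ga]] :
      ~ (spec_set F `<=` spec_set G) by move=> /asboolP.
  exists (spec_basic a); split=> //; first exact: spec_basic_clopen.
  exact: spec_basic_upset.
move=> W [oW cW].
split.
  rewrite openE => F [G WG FG].
  have [a [b [Gab abW]]] : exists a b, (spec_basic a `\` spec_basic b) G /\
    spec_basic a `\` spec_basic b `<=` W by exact/spec_nbhsP/open_nbhs_nbhs.
  apply: filterS (_ : downclosure (spec_basic a `\` spec_basic b) `<=` _) _.
    by move=> K [L /abW WL KL]; exists L.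
  apply: open_nbhs_nbhs; split; last by exists G.
  by rewrite spec_downclosure openC; case: (spec_basic_clopen (himp a b)).
rewrite -openC openE => F FnW; apply: contrapT => nF.
have cptW : compact W by exact: subclosed_compact cW spec_compact _.
have WF a : spec_set F a -> (spec_basic a `&` W) !=set0.
  move=> Fa; apply: contrapT => aW; apply: nF.
  apply: filterS (_ : spec_basic a `<=` _) _; last first.
    by apply: open_nbhs_nbhs; split => //; case: (spec_basic_clopen a).
  move=> K Ka [L WL /asboolP KL]; apply: aW; exists L; split=> //.
  exact: KL.
have [[F1 _ FI] _ _] := spec_prime F.
pose B := filter_from (spec_set F) (fun a => spec_basic a `&` W).
have PB : ProperFilter B.
  apply: filter_from_proper => //; apply: filter_from_filter.
    by exists \top.
  move=> a b Fa Fb; exists (Order.meet a b); first exact: FI.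
  by rewrite -spec_basicI => K [[Ka Kb] WK].
have [|G [WG clG]] := cptW B PB.
  by exists \top => // K [].
apply: FnW; exists G => //; apply/asboolP => a Fa.
have [_ ca] := spec_basic_clopen a.
apply: ca => N /(clG (spec_basic a)); apply.
by exists a => // K [].
Qed.

End Spec.

Record category : Type := Category {
  Ob :> Type;
  Hom : Ob -> Ob -> Type;
  idm : forall A : Ob, Hom A A;
  compm : forall A B D : Ob, Hom B D -> Hom A B -> Hom A D;
  compm1 : forall (A B : Ob) (f : Hom A B), compm f (idm A) = f;
  comp1m : forall (A B : Ob) (f : Hom A B), compm (idm B) f = f;
  compmA : forall (A B D E : Ob) (h : Hom D E) (g : Hom B D) (f : Hom A B),
    compm h (compm g f) = compm (compm h g) f
}.
Arguments Hom {c} A B.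
Arguments idm {c} A.
Arguments compm {c A B D} g f.

Notation "g \oc f" := (compm g f) (at level 50, left associativity).

Section Toposes.
Variable C : category.
Implicit Types A B D E P Q S T : C.

Definition is_terminal T : Prop := forall A, exists! f : Hom A T, True.

Definition is_product A B P (p : Hom P A) (q : Hom P B) : Prop :=
  forall Q (p' : Hom Q A) (q' : Hom Q B),
    exists! u : Hom Q P, p \oc u = p' /\ q \oc u = q'.

Definition is_pullback A B D P (f : Hom A D) (g : Hom B D)
    (p : Hom P A) (q : Hom P B) : Prop :=
  f \oc p = g \oc q /\
  forall Q (p' : Hom Q A) (q' : Hom Q B), f \oc p' = g \oc q' ->
    exists! u : Hom Q P, p \oc u = p' /\ q \oc u = q'.

(* E, with ev : E x A -> B, is an exponential B ^ A; h below is g x A. *)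
Definition is_exponential A B E P (p : Hom P E) (q : Hom P A)
    (ev : Hom P B) : Prop :=
  is_product p q /\
  forall D Q (r : Hom Q D) (s : Hom Q A), is_product r s ->
  forall f : Hom Q B, exists! g : Hom D E, exists h : Hom Q P,
    [/\ p \oc h = g \oc r, q \oc h = s & ev \oc h = f].

Definition monic A B (m : Hom A B) : Prop :=
  forall Q (u v : Hom Q A), m \oc u = m \oc v -> u = v.

Definition is_subobject_classifier T E (t : Hom T E) : Prop :=
  is_terminal T /\
  forall A B (m : Hom A B), monic m ->
    exists! chi : Hom B E, exists u : Hom A T, is_pullback chi t m u.

Definition has_pullbacks : Prop :=
  forall A B D (f : Hom A D) (g : Hom B D),
    exists P (p : Hom P A) (q : Hom P B), is_pullback f g p q.

Definition has_exponentials : Prop :=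
  forall A B, exists E P (p : Hom P E) (q : Hom P A) (ev : Hom P B),
    is_exponential p q ev.

(* Having all finite limits amounts to having a terminal object and
   pullbacks. *)
Definition elementary_topos : Prop :=
  [/\ exists T, is_terminal T,
      has_pullbacks,
      has_exponentials
    & exists T E (t : Hom T E), is_subobject_classifier t].

Record mono_into A : Type := MonoInto {
  mono_dom : C;
  mono_arrow : Hom mono_dom A;
  mono_monic : monic mono_arrow
}.

Definition mono_le A (m n : mono_into A) : Prop :=
  exists h : Hom (mono_dom m) (mono_dom n),
    mono_arrow n \oc h = mono_arrow m.

Record subobject A : Type := Subobject {
  sub_class :> mono_into A -> Prop;
  sub_classP : exists m : mono_into A,
    sub_class = fun n => mono_le m n /\ mono_le n m
}.

Definition sub_le A (S T : subobject A) : Prop :=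
  forall m n, sub_class S m -> sub_class T n -> mono_le m n.

End Toposes.

Definition is_meet (P : Type) (le : P -> P -> Prop) (a b c : P) : Prop :=
  [/\ le c a, le c b & forall x, le x a -> le x b -> le x c].

Definition is_join (P : Type) (le : P -> P -> Prop) (a b c : P) : Prop :=
  [/\ le a c, le b c & forall x, le a x -> le b x -> le c x].

Definition lattice_iso d (L : latticeType d) (P : Type) (le : P -> P -> Prop)
    (phi : L -> P) : Prop :=
  [/\ bijective phi,
      forall a b : L, a <= b <-> le (phi a) (phi b),
      forall a b : L, is_meet le (phi a) (phi b) (phi (Order.meet a b))
    & forall a b : L, is_join le (phi a) (phi b) (phi (Order.join a b))].

Section Slice.
Variables (C : category) (X : C).

Record slice_ob : Type := SliceOb {
  slice_dom : C;
  slice_map : Hom slice_dom X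
}.

Record slice_hom (A B : slice_ob) : Type := SliceHom {
  slice_fun : Hom (slice_dom A) (slice_dom B);
  slice_funP : slice_map B \oc slice_fun = slice_map A
}.

Lemma slice_hom_eq (A B : slice_ob) (f g : slice_hom A B) :
  slice_fun f = slice_fun g -> f = g.
Proof.
case: f g => [f fP] [g gP] /= fg; rewrite fg in fP *; congr SliceHom.
exact: Prop_irrelevance.
Qed.

Definition slice_id (A : slice_ob) : slice_hom A A :=
  SliceHom (compm1 (slice_map A)).

Lemma slice_comp_subproof (A B D : slice_ob) (g : slice_hom B D)
    (f : slice_hom A B) :
  slice_map D \oc (slice_fun g \oc slice_fun f) = slice_map A.
Proof. by rewrite compmA !slice_funP. Qed.

Definition slice_comp (A B D : slice_ob) (g : slice_hom B D)
    (f : slice_hom A B) : slice_hom A D :=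
  SliceHom (slice_comp_subproof g f).

Lemma slice_comp1 (A B : slice_ob) (f : slice_hom A B) :
  slice_comp f (slice_id A) = f.
Proof. by apply: slice_hom_eq; exact: compm1. Qed.

Lemma slice_1comp (A B : slice_ob) (f : slice_hom A B) :
  slice_comp (slice_id B) f = f.
Proof. by apply: slice_hom_eq; exact: comp1m. Qed.

Lemma slice_compA (A B D E : slice_ob) (h : slice_hom D E)
    (g : slice_hom B D) (f : slice_hom A B) :
  slice_comp h (slice_comp g f) = slice_comp (slice_comp h g) f.
Proof. by apply: slice_hom_eq; exact: compmA. Qed.

Definition slice : category :=
  Category slice_comp1 slice_1comp slice_compA.

End Slice.

Record esakia_space : Type := EsakiaSpace {
  esa_disp : Order.disp_t;
  esa_sort :> POrderedTopological.type esa_disp;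
  esa_esakia : esakia esa_sort
}.

Definition spectral_local_homeo (d d' : Order.disp_t)
    (Y : POrderedTopological.type d) (X : POrderedTopological.type d')
    (f : Y -> X) : Prop :=
  local_homeo (f : spectral Y -> spectral X).

Record slh (Y X : esakia_space) : Type := Slh {
  slh_fun :> Y -> X;
  slhP : spectral_local_homeo slh_fun
}.

Lemma slh_eq (Y X : esakia_space) (f g : slh Y X) :
  slh_fun f = slh_fun g -> f = g.
Proof.
case: f g => [f fP] [g gP] /= fg; rewrite fg in fP *; congr Slh.
exact: Prop_irrelevance.
Qed.

Definition slh_id (X : esakia_space) : slh X X :=
  @Slh X X id (@local_homeo_id (spectral X)).

Definition slh_comp (Z Y X : esakia_space) (g : slh Y X) (f : slh Z Y) :
    slh Z X :=
  @Slh Z X (g \o f) (local_homeo_comp (slhP f) (slhP g)).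

Lemma slh_comp1 (Y X : esakia_space) (f : slh Y X) : slh_comp f (slh_id Y) = f.
Proof. exact: slh_eq. Qed.

Lemma slh_1comp (Y X : esakia_space) (f : slh Y X) : slh_comp (slh_id X) f = f.
Proof. exact: slh_eq. Qed.

Lemma slh_compA (W Z Y X : esakia_space) (h : slh Y X) (g : slh Z Y)
    (f : slh W Z) : slh_comp h (slh_comp g f) = slh_comp (slh_comp h g) f.
Proof. exact: slh_eq. Qed.

Definition EsaSlh : category := Category slh_comp1 slh_1comp slh_compA.

Definition EsaEt (X : esakia_space) : category := @slice EsaSlh X.

Definition esakia_spec d (H : heytingType d) : esakia_space :=
  EsakiaSpace (@spec_esakia d H).

(* Main.v *)
From HB Require Import structures.
Require Import Defs.
From mathcomp Require Import all_boot all_order.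
From mathcomp Require Import all_classical topology.

Set Implicit Arguments.
Unset Strict Implicit.
Unset Printing Implicit Defensive.

Import Order.TTheory.
Local Open Scope order_scope.
Local Open Scope classical_set_scope.

(** Write X for the Esakia space Spec(H). The proof rests on a description of the
objects of EsaEt(X) by finite data attached to clopen upsets.

A spectral local homeomorphism p : Y -> X is covered by finitely many clopen
upsets V i of Y, on each of which p is injective; then all the p(V i `&` V j)
are clopen upsets of X, and a subset S of Y is a clopen upset exactly when all
the p(S `&` V i) are. Conversely, any map p from a bare set Y to X that has such
a family V, called an atlas, comes from a structure of Esakia space on Y
([total_esakia], [total_ob]). A function between two
objects of EsaEt(X), compatible with the maps to X, is a morphism exactly when
the preimages of clopen upsets are clopen upsets ([fn_cu] and [mk_hom]). So every
object can be given by its underlying set and an atlas, and every universal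
property can be checked on points. In particular pullbacks are fibre products of
sets, and monomorphisms are injections.

Jibladze's law enters once. It says that the finitely many clopen upsets B j that
come from the elements j of H0 form a local basis: near each point x, that is, on
the principal upset of x, every clopen upset of X coincides with some B j
([jibladze_local_basis]). Hence finite families, indexed by a finite type K, of
germs of clopen upsets form an object of EsaEt(X): the atlas is indexed by the
functions from K to H0, and is finite because H0 is. Morphisms from A to this
object are K-indexed families of clopen upsets of A ([germ_hom_ex],
[germ_hom_ext]). With K a singleton this is the subobject classifier. Cutting out,
by conditions that define clopen upsets, the families that are graphs of germs of
maps from A to D, for K the product of the index types of charts of A and of D,
gives the exponential. The conditions are implications between clopen upsets, and
they define clopen upsets because X is an Esakia space.

Finally, the subobjects of any object A are its clopen upsets ([sub_le_of],
[sub_of_ex]); a terminal object is carried by X itself, and the clopen upsets of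
Spec(H) are the sets of prime filters that contain a given element of H
([cu_spec]). *)

(** * Compactness and clopen upsets *)

(** Compactness as an induction principle: an ideal of subsets that contains a
neighbourhood of each point of [K] contains [K]. *)
Lemma compact_ind (T : topologicalType) (K : set T) (P : set T -> Prop) :
  compact K -> P set0 -> (forall A B, P A -> P B -> P (A `|` B)) ->
  (forall A B, A `<=` B -> P B -> P A) ->
  (forall x, K x -> exists2 N, nbhs x N & P N) -> P K.
Proof.
move=> cK P0 PU PS Px; apply: contrapT => nPK.
pose F : set (set T) := [set A | P (K `\` A)].
have FF : ProperFilter F.
  apply: Build_ProperFilter_ex.
    move=> A FA; apply: contrapT => nA; apply: nPK; apply: PS FA => x Kx.
    by split=> // Ax; apply: nA; exists x.
  split; rewrite /F /=.
  - by apply: PS P0 => x [_ /(_ I)].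
  - move=> A B FA FB; apply: PS (PU _ _ FA FB) => x [Kx nAB].
    by have [Ax|nAx] := EM (A x); [right; split=> // Bx; apply: nAB|left].
  - by move=> A B AB; apply: PS => x [Kx nBx]; split=> // /AB.
have FK : F K by apply: PS P0 => x [Kx /(_ Kx)].
have [x [Kx clx]] := cK F FF FK.
have [N xN PN] := Px x Kx.
have FN : F (~` N) by apply: PS PN => y [_ /contrapT].
by have [y []] := clx _ _ FN xN.
Qed.

Section ClopenUpsets.
Variables (d : Order.disp_t) (X : POrderedTopological.type d).
Implicit Types S T W : set X.

(** Clopen upsets, the compact open sets of the spectral topology. *)
Definition cu S : Prop := clopen S /\ upset S.

Lemma cu_open S : cu S -> open S. Proof. by case=> -[]. Qed.

Lemma cu_spectral S : cu S -> open (S : set (spectral X)).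
Proof. by move=> cS; split; [exact: cu_open|case: cS]. Qed.

Lemma cuT : cu [set: X].
Proof. by split; [exact: clopenT|]. Qed.

Lemma cu0 : cu (@set0 X).
Proof. by split; [exact: clopen0|]. Qed.

Lemma clopen_exists (I : finType) (V : I -> set X) :
  (forall i, clopen (V i)) -> clopen [set x | exists i, V i x].
Proof.
move=> cV; have -> : [set x | exists i, V i x] = \big[setU/set0]_i V i.
  apply/seteqP; split=> x /=.
    by case=> i Vi; rewrite (bigD1 i) //=; left.
  by elim/big_ind: _ => // [A B PA PB [/PA|/PB]//|i _ Vx]; exists i.
by elim/big_ind: _ => //; [exact: clopen0|exact: clopenU].
Qed.

Lemma cuI S T : cu S -> cu T -> cu (S `&` T).
Proof.
move=> [cS uS] [cT uT]; split; first exact: clopenI.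
by move=> x y xy [Sx Tx]; split; [exact: uS Sx|exact: uT Tx].
Qed.

Lemma cuU S T : cu S -> cu T -> cu (S `|` T).
Proof.
move=> [cS uS] [cT uT]; split; first exact: clopenU.
by move=> x y xy [Sx|Tx]; [left; exact: uS Sx|right; exact: uT Tx].
Qed.

Lemma cu_exists (I : finType) (V : I -> set X) :
  (forall i, cu (V i)) -> cu [set x | exists i, V i x].
Proof.
move=> cV; split; last first.
  by move=> x y xy [i Vx]; exists i; have [_ u] := cV i; exact: u Vx.
by apply: clopen_exists => i; case: (cV i).
Qed.

Lemma cu_forall (I : finType) (V : I -> set X) :
  (forall i, cu (V i)) -> cu [set x | forall i, V i x].
Proof.
move=> cV; split; last by move=> x y xy Vx i; have [_ u] := cV i; exact: u (Vx i).
have -> : [set x | forall i, V i x] = ~` [set x | exists i, (~` V i) x].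
  apply/seteqP; split=> x /=; first by move=> Vx [i]; exact.
  by move=> Vx i; apply: contrapT => nV; apply: Vx; exists i.
apply: (clopenC set0); apply: clopen_exists => i.
by apply: (clopenC set0); case: (cV i).
Qed.

(** Heyting implication of clopen upsets; this is where the Esakia condition is
used. *)
Lemma cu_imp S T : esakia X -> cu S -> cu T ->
  cu [set x | forall y, x <= y -> S y -> T y].
Proof.
move=> [_ eX] [cS _] [cT _]; split; last first.
  by move=> x y xy Sx z yz; apply: Sx; exact: le_trans yz.
have -> : [set x | forall y, x <= y -> S y -> T y] = ~` downclosure (S `\` T).
  apply/seteqP; split=> x /=; first by move=> xST [y [Sy nTy] /xST /(_ Sy)].
  by move=> nx y xy Sy; apply: contrapT => nTy; apply: nx; exists y.
apply: (clopenC set0); apply: eX; rewrite setDE; apply: clopenI => //.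
exact: (clopenC set0).
Qed.

Lemma priestley_compact : priestley X -> forall S, closed S -> compact S.
Proof. by move=> [cX _] S cS; exact: subclosed_compact cS cX _. Qed.

(** The clopen upsets form a basis of the spectral topology. *)
Lemma open_upset_cu W x : priestley X -> open_upset W -> W x ->
  exists S, [/\ cu S, S x & S `<=` W].
Proof.
move=> pX [oW uW] Wx.
have cW : compact (~` W) by apply: priestley_compact => //; rewrite closedC.
suff [S [cS Sx WS]] : exists S, [/\ cu S, S x & ~` W `<=` ~` S].
  by exists S; split=> // y Sy; apply: contrapT => /WS.
apply: (compact_ind (P := fun B => exists S, [/\ cu S, S x & B `<=` ~` S]))
    => //.
- by exists setT; split=> //; exact: cuT.
- move=> A B [S [cS Sx AS]] [T [cT Tx BT]]; exists (S `&` T); split=> //.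
    exact: cuI.
  by move=> y [/AS nS|/BT nT] [].
- by move=> A B AB [S [cS Sx BS]]; exists S; split=> // y /AB /BS.
- move=> y nWy; have [|U [cU uU Ux nUy]] := pX.2 x y.
    by move=> xy; apply: nWy; exact: uW Wx.
  exists (~` U); last by exists U; split.
  by apply: open_nbhs_nbhs; split=> //; rewrite openC; case: cU.
Qed.

End ClopenUpsets.

(** * Charts of spectral local homeomorphisms *)

(** A chart of [f] is a clopen upset on which [f] is injective and carries clopen
upsets to clopen upsets. *)
Definition chart d d' (Y : POrderedTopological.type d)
    (X : POrderedTopological.type d') (f : Y -> X) (V : set Y) : Prop :=
  [/\ cu V, forall y y', V y -> V y' -> f y = f y' -> y = y' &
    forall S, cu S -> S `<=` V -> cu (f @` S)].

Section SpectralLocalHomeo.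
Variables (d d' : Order.disp_t) (Y : POrderedTopological.type d).
Variables (X : POrderedTopological.type d') (f : Y -> X).
Hypotheses (pY : priestley Y) (pX : priestley X).

Lemma slh_open_upset W : spectral_local_homeo f -> open_upset W ->
  open_upset (f @^-1` W).
Proof.
move=> lf oW; suff : open (f @^-1` W : set (spectral Y)) by [].
rewrite openE => y Wfy.
have [U [oU Uy _ [cf _]]] := lf y.
move: cf; rewrite continuous_open_subspace // => cf.
have := cf y (mem_set Uy) W; apply; apply: open_nbhs_nbhs; split=> //.
Qed.

(** The image of a clopen upset [S] on which [f] is a homeomorphism is an open
upset; being covered, by compactness of [S], by finitely many clopen upsets that
it contains, it is clopen. *)
Lemma slh_chart (y : Y) : spectral_local_homeo f -> exists2 V, chart f V & V y.
Proof.
move=> lf; have [U [oU Uy ofU [cf [g cg fK]]]] := lf y.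
move: cg; rewrite continuous_open_subspace // => cg.
have [V [cV Vy VU]] := open_upset_cu pY (oU : open_upset U) Uy.
have inj z z' : U z -> U z' -> f z = f z' -> z = z'.
  by move=> Uz Uz' fz; rewrite -(fK z) // fz fK.
have oim (S : set Y) : cu S -> S `<=` U -> open_upset (f @` S).
  move=> cS SU; suff : open (f @` S : set (spectral X)) by [].
  rewrite openE => _ [z Sz <-].
  have fUz : (f z) \in f @` U by apply/mem_set; exists z => //; exact: SU.
  have nS : nbhs (g (f z)) (S : set (spectral Y)).
    rewrite fK; last exact: SU.
    by apply: open_nbhs_nbhs; split=> //; exact: cu_spectral.
  have nU : nbhs (f z : spectral X) (f @` U : set (spectral X)).
    by apply: open_nbhs_nbhs; split=> //; exact: set_mem.
  have gS : nbhs (f z : spectral X) (g @^-1` S) by exact: cg.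
  apply: filterS (filterI gS nU) => x [Sgx [w Uw wx]].
  by exists w => //; move: Sgx; rewrite /= -wx fK.
exists V => //; split=> //; first by move=> z z' /VU Uz /VU; exact: inj.
move=> S cS SV.
have SU : S `<=` U by move=> z /SV /VU.
have cptS : compact S by apply: priestley_compact => //; case: cS => -[].
suff [T [cT TS ST]] : exists T, [/\ cu T, T `<=` f @` S & f @` S `<=` T].
  by have -> : f @` S = T by apply/seteqP.
apply: (compact_ind
    (P := fun B => exists T, [/\ cu T, T `<=` f @` S & f @` B `<=` T])) => //.
- by exists set0; split=> //; [exact: cu0|rewrite image_set0].
- move=> A B [S1 [cS1 SW AS]] [T [cT TW BT]]; exists (S1 `|` T); split.
  + exact: cuU.
  + by rewrite subUset.
  + by rewrite image_setU; exact: setUSS.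
- move=> A B AB [T [cT TS BT]]; exists T; split=> //.
  by apply: subset_trans BT; exact: image_subset.
- move=> z Sz.
  have [|T [cT Tz TS]] := open_upset_cu pX (oim _ cS SU) (_ : (f @` S) (f z)).
    by exists z.
  exists (f @^-1` T); last by exists T; split=> // _ [w Tw <-].
  apply: open_nbhs_nbhs; split=> //; apply: (slh_open_upset lf _).1.
  by split; [exact: cu_open|case: cT].
Qed.

(** A spectral local homeomorphism is thus also continuous for the Priestley
topologies. On a chart [V], the set [V `&` f @^-1` T] is an open upset whose image
is compact, so it is a finite union of clopen upsets. *)
Lemma slh_cu T : spectral_local_homeo f -> cu T -> cu (f @^-1` T).
Proof.
move=> lf cT.
have [oT uT] := slh_open_upset lf (cu_spectral cT).
split=> //; split=> //; rewrite -openC openE => y nTy.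
have [V [cV inj im] Vy] := slh_chart y lf.
suff cVT : cu (V `&` f @^-1` T).
  have : nbhs y (V `&` ~` (V `&` f @^-1` T)).
    apply: open_nbhs_nbhs; split; last by split=> // -[].
    by apply: openI; [exact: cu_open|rewrite openC; case: cVT => -[]].
  by apply: filterS => z [Vz nz] Tz; apply: nz.
have VTE : V `&` f @^-1` T = V `&` f @^-1` (T `&` f @` V).
  apply/seteqP; split=> z [Vz]; last by case.
  by move=> Tz; split=> //; split=> //; exists z.
have cTV : cu (T `&` f @` V) by apply: cuI => //; exact: im.
have cpt : compact (T `&` f @` V).
  by apply: priestley_compact => //; case: cTV => -[].
suff [S [cS SV VS]] : exists S, [/\ cu S, S `<=` V `&` f @^-1` T &
    V `&` f @^-1` (T `&` f @` V) `<=` S].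
  have -> // : V `&` f @^-1` T = S by apply/seteqP; split=> //; rewrite VTE.
apply: (compact_ind (P := fun B => exists S, [/\ cu S, S `<=` V `&` f @^-1` T
    & V `&` f @^-1` B `<=` S])) => //.
- by exists set0; split=> //; exact: cu0.
- move=> A B [S1 [cS1 SW AS]] [S2 [cS2 TW BT]]; exists (S1 `|` S2); split.
  + exact: cuU.
  + by rewrite subUset.
  + by rewrite preimage_setU setIUr; exact: setUSS.
- move=> A B AB [S [cS TS BT]]; exists S; split=> // z [Vz Az].
  by apply: BT; split=> //; exact: AB.
- move=> x [Tx [z Vz zx]]; rewrite -{x}zx in Tx *.
  have oz : open_upset (V `&` f @^-1` T).
    split; first by apply: openI => //; exact: cu_open.
    move=> u v uv [Vu Tu]; split; last exact: uT Tu.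
    by case: cV => _ upV; exact: upV Vu.
  have [|S [cS Sz ST]] := open_upset_cu pY oz (_ : (V `&` f @^-1` T) z) => //.
  have SV : S `<=` V by move=> u /ST [].
  exists (f @` S).
    apply: open_nbhs_nbhs; split; last by exists z.
    by apply: cu_open; exact: im.
  exists S; split=> // u [Vu [v Sv vu]].
  by rewrite -(inj _ _ (SV _ Sv) Vu vu).
Qed.

Lemma slh_of_charts : (forall T, cu T -> cu (f @^-1` T)) ->
  (forall y, exists2 V, chart f V & V y) -> spectral_local_homeo f.
Proof.
move=> fcu ch y; have [V [cV inj im] Vy] := ch y.
have oV : open (V : set (spectral Y)) by exact: cu_spectral.
have ofV : open (f @` V : set (spectral X)) by exact/cu_spectral/im.
exists V; split=> //; split.
  rewrite continuous_open_subspace // => z _ N /=.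
  rewrite nbhsE => -[B [oB Bz] BN].
  have [T [cT Tz TB]] := open_upset_cu pX (oB : open_upset B) Bz.
  have oT : open (f @^-1` T : set (spectral Y)) by exact/cu_spectral/fcu.
  by apply: filterS (open_nbhs_nbhs (conj oT (Tz : (f @^-1` T) z))) => w /TB /BN.
(* The inverse of f on f(V), extended by the default value y. *)
pose g x : Y := if pselect (exists2 z, V z & f z = x) is left e
  then projT1 (cid2 e) else y.
have gK z : V z -> g (f z) = z.
  move=> Vz; rewrite /g; case: pselect => [e|[]]; last by exists z.
  by case: cid2 => w /= Vw /inj; apply.
exists g => //.
rewrite continuous_open_subspace // => _ /set_mem [z Vz <-] N /=.
rewrite gK // nbhsE => -[B [oB Bz] BN].
have [S [cS Sz SB]] :=
  open_upset_cu pY (openI oB oV : open_upset (B `&` V)) (conj Bz Vz).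
have SV : S `<=` V by move=> w /SB [].
have oS : open (f @` S : set (spectral X)) by exact/cu_spectral/im.
apply: filterS (open_nbhs_nbhs (conj oS (_ : (f @` S) (f z)))); last by exists z.
by move=> _ [w Sw <-] /=; rewrite gK; [apply: BN; have [] := SB _ Sw|exact: SV].
Qed.

End SpectralLocalHomeo.

(** * Spaces glued from finite atlases *)

Section Atlas.
Variable X : esakia_space.

(** A finite atlas on a map [p] from a bare type: subsets that cover [Y], on which
[p] is injective, and whose pairwise intersections have clopen upsets as images.
Taking [i = j], the images of the charts themselves are clopen upsets. *)
Definition atlas (Y : Type) (p : Y -> X) (I : finType) (V : I -> set Y) : Prop :=
  [/\ forall i y y', V i y -> V i y' -> p y = p y' -> y = y',
      forall y, exists i, V i y &
      forall i j, cu (p @` (V i `&` V j))].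

Section Total.
Variables (Y : Type) (p : Y -> X) (I : finType) (V : I -> set Y).
Hypothesis aV : atlas p V.

(** A copy of [Y], to carry the order and the topology that are determined by the
atlas. *)
Definition total of atlas p V : Type := Y.

(** The subsets of [Y] that will be the clopen upsets. *)
Definition definable (S : set Y) : Prop := forall i, cu (p @` (S `&` V i)).

Let inj i y y' : V i y -> V i y' -> p y = p y' -> y = y'.
Proof. by case: aV => inj _ _; exact: inj. Qed.

Let cov y : exists i, V i y. Proof. by case: aV. Qed.

Lemma definableV i : definable (V i).
Proof. by move=> j; case: aV. Qed.

Lemma definable_pre T : cu T -> definable (p @^-1` T).
Proof.
move=> cT i; have -> : p @` (p @^-1` T `&` V i) = T `&` p @` (V i `&` V i).
  apply/seteqP; split=> x; first by move=> [y [Ty Vy] <-]; split=> //; exists y.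
  by move=> [Tx [y [Vy _] yx]]; exists y => //; split=> //=; rewrite /preimage /= yx.
by apply: cuI => //; exact: definableV.
Qed.

(** The specialization order of the topology generated by the definable sets. *)
Definition total_le (y y' : total aV) : bool :=
  `[< forall S : set Y, definable S -> S y -> S y' >].

Let le_refl : reflexive total_le.
Proof. by move=> y; apply/asboolP. Qed.

Lemma total_le_p (y y' : total aV) : total_le y y' -> p y <= p y'.
Proof.
move/asboolP => yy'; apply: contrapT => npp.
have [_ sep] := (esa_esakia X).1.
have [U [cU uU Uy nUy']] := sep _ _ npp.
by apply: nUy'; exact: (yy' _ (definable_pre (conj cU uU))).
Qed.

Let le_anti : antisymmetric total_le.
Proof.
move=> y y' /andP[yy' y'y].
have pE : p y = p y' by apply/le_anti; rewrite !total_le_p.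
have [i Vy] := cov y; apply: (inj Vy) pE.
by move/asboolP: yy'; apply=> //; exact: definableV.
Qed.

Let le_trans : transitive total_le.
Proof.
move=> y x z /asboolP xy /asboolP yz; apply/asboolP => S dS Sx.
by apply: yz => //; exact: xy.
Qed.

(** The topology coinduced by the inverses of [p] on the images of the charts. *)
Definition total_open (W : set (total aV)) : Prop :=
  forall i, open (p @` (W `&` V i)).

Let openT_ : total_open setT.
Proof.
move=> i; have := cu_open (definableV i i).
by rewrite setTI setIid.
Qed.

Let openI_ : setI_closed total_open.
Proof.
move=> A B oA oB i; have -> : p @` (A `&` B `&` V i) =
    p @` (A `&` V i) `&` p @` (B `&` V i).
  apply/seteqP; split=> x.
    by move=> [y [[Ay By] Vy] <-]; split; exists y.
  move=> [[y [Ay Vy] <-] [y' [By' Vy'] yy']].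
  by exists y => //; split=> //; split=> //; rewrite (inj Vy Vy' (esym yy')).
exact: openI.
Qed.

Let open_bigU_ (J : Type) (f : J -> set (total aV)) :
  (forall j, total_open (f j)) -> total_open (\bigcup_j f j).
Proof.
move=> of_ i; rewrite setI_bigcupl image_bigcup.
by apply: bigcup_open => j _; exact: of_.
Qed.

HB.instance Definition _ := gen_eqMixin (total aV).
HB.instance Definition _ := gen_choiceMixin (total aV).
HB.instance Definition _ := @Order.Le_isPOrder.Build spec_display (total aV)
  total_le le_refl le_anti le_trans.
HB.instance Definition _ := @isOpenTopological.Build (total aV)
  total_open openT_ openI_ open_bigU_.

Lemma total_openE (W : set (total aV)) : open W = total_open W.
Proof. by []. Qed.

(** Charts are order isomorphisms onto their images. *)
Lemma total_lift i (y y' : total aV) : V i y -> V i y' -> p y <= p y' -> y <= y'.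
Proof.
move=> Vy Vy' pyy'; apply/asboolP => S dS Sy.
have [_ up] := dS i; have [|z [Sz Vz] zy'] := up _ _ pyy'; first by exists y.
by rewrite -(inj Vz Vy' zy').
Qed.

Lemma clopen_total (W : set (total aV)) :
  (forall i, clopen (p @` (W `&` V i))) <-> clopen W.
Proof.
have pVC i : p @` (~` W `&` V i) = p @` (V i `&` V i) `\` p @` (W `&` V i).
  apply/seteqP; split=> x.
    move=> [y [nWy Vy] <-]; split; first by exists y.
    by move=> [z [Wz Vz] zy]; apply: nWy; rewrite -(inj Vz Vy zy).
  move=> [[y [Vy _] <-] nW]; exists y => //; split=> // Wy; apply: nW.
  by exists y.
split.
  move=> cW; split; first by rewrite total_openE => i; case: (cW i).
  rewrite -openC total_openE => i; rewrite pVC; apply: openI.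
    exact: cu_open (definableV i i).
  by rewrite openC; case: (cW i).
rewrite /clopen -openC !total_openE => -[oW cW] i; split; first exact: oW.
move: cW => /(_ i); rewrite pVC => oC.
rewrite -openC; have -> : ~` (p @` (W `&` V i)) =
    (p @` (V i `&` V i) `\` p @` (W `&` V i)) `|` ~` (p @` (V i `&` V i)).
  apply/seteqP; split=> x /=.
    by have [px|] := EM ((p @` (V i `&` V i)) x); [left|right].
  move=> [[]//|npx [y [Wy Vy] yx]]; apply: npx; exists y => //.
apply: openU => //; rewrite openC.
by case: (definableV i i) => -[].
Qed.

Lemma cu_total (W : set (total aV)) : cu W <-> definable W.
Proof.
split; last first.
  move=> dW; split; first by apply/clopen_total => i; case: (dW i).
  by move=> y y' /asboolP yy'; exact: yy'.
move=> [/clopen_total cW uW] i; split=> // x x' xx' [y [Wy Vy] yx].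
have [_ up] := definableV i i.
have [|y' [Vy' _] yx'] := up _ _ xx'; first by exists y.
exists y' => //; split=> //; apply: uW Wy.
by apply: (total_lift Vy Vy'); rewrite yx yx'.
Qed.

(** [V i] is homeomorphic to its image, which is closed in the compact space
[X]. *)
Let compactV i : compact (V i : set (total aV)).
Proof.
move=> F FF FV.
have cpV : compact (p @` (V i `&` V i)).
  have [[_ clo] _] := definableV i i.
  by apply: priestley_compact => //; exact: (esa_esakia X).1.
have pFV : F (p @^-1` (p @` (V i `&` V i))).
  by apply: filterS FV => y Vy; exists y.
have [x [[y [Vy _] yx] clx]] := cpV (p @ F) (fmap_proper_filter _ _) pFV.
exists y; split=> // A N FA; rewrite nbhsE => -[W [oW Wy] WN].
have [||_ [[z [Az Vz] <-] [w [Ww Vw] wz]]] :=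
    clx (p @` (A `&` V i)) (p @` (W `&` V i)).
- suff : F (p @^-1` (p @` (A `&` V i))) by [].
  by apply: filterS (filterI FA FV) => z Az; exists z.
- by apply: open_nbhs_nbhs; split; [exact: oW|rewrite -yx; exists y].
- by exists z; split=> //; apply: WN; rewrite -(inj Vw Vz wz).
Qed.

Lemma total_compact : compact [set: total aV].
Proof.
have -> : [set: total aV] = \big[setU/set0]_i (V i : set (total aV)).
  apply/seteqP; split=> // y _; have [i Vy] := cov y.
  by rewrite (bigD1 i) //=; left.
by elim/big_ind: _ => //; [exact: compact0|exact: compactU].
Qed.

Lemma total_esakia : esakia (total aV).
Proof.
split; first split; first exact: total_compact.
  move=> y y' nyy'.
  have /existsNP [S /not_implyP [dS /not_implyP [Sy nSy']]] :
      ~ forall S : set Y, definable S -> S y -> S y' by move=> /asboolP.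
  by exists S; have [cS uS] := (cu_total S).2 dS; split.
move=> W /clopen_total cW; apply/clopen_total => i.
have -> : p @` (downclosure W `&` V i) =
    p @` (V i `&` V i) `&` downclosure (p @` (W `&` V i)).
  apply/seteqP; split=> x.
    move=> [y [[z Wz yz] Vy] <-]; split; first by exists y.
    exists (p z); last exact: total_le_p.
    exists z => //; split=> //; move/asboolP: yz; apply=> //.
    exact: definableV.
  move=> [[y [Vy _] <-] [_ [z [Wz Vz] <-] yz]]; exists y => //; split=> //.
  by exists z => //; exact: (total_lift Vy Vz).
apply: clopenI; first by case: (definableV i i).
exact: (esa_esakia X).2.
Qed.

Definition total_space : esakia_space := EsakiaSpace total_esakia.

Lemma total_slh : spectral_local_homeo (p : total_space -> X).
Proof.
apply: slh_of_charts => [||T cT|y]; [exact: total_esakia.1|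
  exact: (esa_esakia X).1|exact/cu_total/definable_pre|].
have [i Vy] := cov y; exists (V i) => //; split=> //.
- exact/cu_total/definableV.
- exact: inj.
- move=> S /cu_total dS SV; have := dS i.
  by rewrite (_ : S `&` V i = S) //; apply/setIidPl.
Qed.

(** The object of EsaEt(X) given by an atlas. Its points are those of [Y] and its
map to [X] is [p], both by conversion. *)
Definition total_ob : EsaEt X :=
  @SliceOb EsaSlh X total_space (Slh total_slh).

End Total.
End Atlas.

(** * Objects and morphisms of EsaEt(X) *)

Section Objects.
Variable X : esakia_space.
Implicit Types A B D : EsaEt X.

(** The underlying space of an object, its map to the base, and the underlying
function of a morphism. *)
Definition car A : esakia_space := slice_dom A.
Definition pr A : car A -> X := slh_fun (slice_map A).
Definition fn A B (u : Hom A B) : car A -> car B := slh_fun (slice_fun u).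

Lemma pr_slh A : spectral_local_homeo (@pr A).
Proof. exact: slhP. Qed.

Lemma fn_pr A B (u : Hom A B) a : pr (fn u a) = pr a.
Proof.
by have := slice_funP u; move/(congr1 (@slh_fun _ _))/(congr1 (@^~ a)).
Qed.

Lemma fn_comp A B D (v : Hom B D) (u : Hom A B) a : fn (v \oc u) a = fn v (fn u a).
Proof. by []. Qed.

Lemma hom_ext A B (u v : Hom A B) : (forall a, fn u a = fn v a) -> u = v.
Proof.
by move=> uv; apply: slice_hom_eq; apply: slh_eq; apply/funext.
Qed.

Lemma fn_cu A B (u : Hom A B) S : cu S -> cu (fn u @^-1` S).
Proof.
apply: slh_cu; last exact: slhP.
  exact: (esa_esakia (car A)).1.
exact: (esa_esakia (car B)).1.
Qed.

Lemma pr_cu A S : cu S -> cu (@pr A @^-1` S).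
Proof.
apply: slh_cu; last exact: pr_slh.
  exact: (esa_esakia (car A)).1.
exact: (esa_esakia X).1.
Qed.

Lemma charts_ex A : exists (I : finType) (V : I -> set (car A)),
  (forall i, chart (@pr A) (V i)) /\ forall a, exists i, V i a.
Proof.
suff [I [V [cV VT]]] : exists (I : finType) (V : I -> set (car A)),
  (forall i, chart (@pr A) (V i)) /\ [set: car A] `<=` [set a | exists i, V i a].
  by exists I, V; split=> // a; exact: VT.
pose P (B : set (car A)) := exists (I : finType) (V : I -> set (car A)),
  (forall i, chart (@pr A) (V i)) /\ B `<=` [set a | exists i, V i a].
suff : P [set: car A] by [].
apply: (@compact_ind _ _ P); rewrite {}/P.
- exact: (esa_esakia (car A)).1.1.
- by exists void, (fun=> set0); split=> // -[].
- move=> B C [I [V [cV BV]]] [J [W [cW CW]]].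
  exists (I + J)%type, (fun k => match k with inl i => V i | inr j => W j end).
  split; first by case.
  move=> a [/BV [i Vi]|/CW [j Wj]]; first by exists (inl i).
  by exists (inr j).
- by move=> B C BC [I [V [cV CV]]]; exists I, V; split=> // a /BC /CV.
- move=> a _.
  have [V cV Va] := slh_chart (esa_esakia (car A)).1 (esa_esakia X).1 a (@pr_slh A).
  exists V; last by exists unit, (fun=> V); split=> // b Vb; exists tt.
  by apply: open_nbhs_nbhs; split=> //; apply: cu_open; case: cV.
Qed.

(** A chosen finite family of charts of [A], covering it: index type and charts. *)
Definition ix A : finType := sval (cid (charts_ex A)).
Definition ch A : ix A -> set (car A) :=
  sval (cid (svalP (cid (charts_ex A)))).

Lemma ch_chart A (i : ix A) : chart (@pr A) (ch i).
Proof. exact: (svalP (cid (svalP (cid (charts_ex A))))).1. Qed.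

Lemma ch_cov A (a : car A) : exists i : ix A, ch i a.
Proof. exact: (svalP (cid (svalP (cid (charts_ex A))))).2. Qed.

Lemma ch_cu A (i : ix A) : cu (ch i).
Proof. by case: (ch_chart i). Qed.

Lemma ch_inj A (i : ix A) a b : ch i a -> ch i b -> pr a = pr b -> a = b.
Proof. by have [_ + _] := ch_chart i; apply. Qed.

Lemma im_setI_ch A (S : set (car A)) i : cu S -> cu (@pr A @` (S `&` ch i)).
Proof.
by have [cV _ im] := ch_chart i => cS; apply: im; [exact: cuI|move=> a []].
Qed.

Lemma pr_im A (S : set (car A)) : cu S -> cu (@pr A @` S).
Proof.
move=> cS; have -> : @pr A @` S = [set x | exists i, (@pr A @` (S `&` ch i)) x].
  apply/seteqP; split=> x.
    by move=> [a Sa <-]; have [i Va] := ch_cov a; exists i, a.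
  by move=> [i [a [Sa _] <-]]; exists a.
by apply: cu_exists => i; exact: im_setI_ch.
Qed.

(** Whether a subset is a clopen upset can be tested in the charts. *)
Lemma cu_ch A (S : set (car A)) : (forall i, cu (@pr A @` (S `&` ch i))) -> cu S.
Proof.
move=> cS; have -> : S =
    [set a | exists i, (ch i `&` @pr A @^-1` (@pr A @` (S `&` ch i))) a].
  apply/seteqP; split=> a.
    by move=> Sa; have [i Va] := ch_cov a; exists i; split=> //; exists a.
  by move=> [i [Va [b [Sb Vb] ba]]]; rewrite -(ch_inj Vb Va ba).
by apply: cu_exists => i; apply: cuI; [exact: ch_cu|exact: pr_cu].
Qed.

Lemma fn_im A B (u : Hom A B) S : cu S -> cu (fn u @` S).
Proof.
move=> cS; apply: cu_ch => i.
have -> : @pr B @` (fn u @` S `&` ch i) = @pr A @` (S `&` fn u @^-1` (ch i)).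
  apply/seteqP; split=> x.
    by move=> [_ [[a Sa <-] Va] <-]; exists a => //; rewrite fn_pr.
  by move=> [a [Sa Va] <-]; exists (fn u a); rewrite ?fn_pr //; split=> //; exists a.
by apply: pr_im; apply: cuI => //; apply: fn_cu; exact: ch_cu.
Qed.

Lemma cu_le A (a b : car A) : (forall S, cu S -> S a -> S b) -> a <= b.
Proof.
move=> ab; apply: contrapT => nab.
have [U [cU uU Ua nUb]] := (esa_esakia (car A)).1.2 _ _ nab.
by apply: nUb; apply: (ab U).
Qed.

Lemma pr_le A (a b : car A) : a <= b -> pr a <= pr b.
Proof.
move=> ab; apply: contrapT => nab.
have [U [cU uU Ua nUb]] := (esa_esakia X).1.2 _ _ nab.
by apply: nUb; have [_ up] := pr_cu A (conj cU uU); exact: up ab Ua.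
Qed.

Lemma fn_le A B (u : Hom A B) (a b : car A) : a <= b -> fn u a <= fn u b.
Proof.
move=> ab; apply: cu_le => S cS; have [_ up] := fn_cu u cS; exact: up.
Qed.

Lemma cu_up A (S : set (car A)) a b : cu S -> a <= b -> S a -> S b.
Proof. by move=> [_ uS] ab; exact: uS. Qed.

(** A principal upset of [A] is mapped isomorphically onto a principal upset of
[X]: uniqueness of lifts, and their existence ([ch_lift], [lift_ex]). *)
Lemma lift_uniq A (a b b' : car A) : a <= b -> a <= b' -> pr b = pr b' -> b = b'.
Proof.
move=> ab ab'; have [i Va] := ch_cov a.
by apply: (@ch_inj _ i); [apply: cu_up ab Va|apply: cu_up ab' Va]; exact: ch_cu.
Qed.

Lemma ch_lift A (i : ix A) (a : car A) x : ch i a -> pr a <= x ->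
  exists b, [/\ a <= b, pr b = x & ch i b].
Proof.
move=> Va ax; have [_ up] := pr_im (ch_cu i).
have [|b Vb bx] := up _ _ ax; first by exists a.
exists b; split=> //; apply: cu_le => S cS Sa.
have [_ up'] := im_setI_ch i cS.
have [|c [Sc Vc] cx] := up' _ _ ax; first by exists a.
by rewrite (ch_inj Vb Vc) // bx.
Qed.

Lemma lift_ex A (a : car A) x : pr a <= x -> exists2 b, a <= b & pr b = x.
Proof.
move=> ax; have [i Va] := ch_cov a.
by have [b [ab bx _]] := ch_lift Va ax; exists b.
Qed.

(** A function over [X] is a morphism as soon as preimages of clopen upsets are
clopen upsets: such a function is automatically a local homeomorphism. *)
Section MakeHom.
Variables (A B : EsaEt X) (g : car A -> car B).
Hypotheses (gpr : forall a, pr (g a) = pr a)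
  (gcu : forall S, cu S -> cu (g @^-1` S)).

Lemma mk_slh : spectral_local_homeo g.
Proof.
apply: slh_of_charts gcu _; first exact: (esa_esakia (car A)).1.
  exact: (esa_esakia (car B)).1.
move=> a; have [i Va] := ch_cov a; have [j Wa] := ch_cov (g a).
exists (ch i `&` g @^-1` ch j) => //; split.
- by apply: cuI; [exact: ch_cu|apply: gcu; exact: ch_cu].
- by move=> b b' [Vb _] [Vb' _] bb'; apply: (ch_inj Vb Vb'); rewrite -!gpr bb'.
move=> S cS SV; have -> : g @` S = ch j `&` @pr B @^-1` (@pr A @` S).
  apply/seteqP; split=> b.
    move=> [c Sc <-]; have [_ Wc] := SV _ Sc; split=> //.
    by exists c; rewrite // gpr.
  move=> [Wb [c Sc cb]]; exists c => //; have [_ Wc] := SV _ Sc.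
  by apply: (ch_inj Wc Wb); rewrite gpr.
by apply: cuI; [exact: ch_cu|exact/pr_cu/pr_im].
Qed.

Definition mk_hom : Hom A B.
Proof.
refine (@SliceHom EsaSlh X A B (Slh mk_slh) _).
by apply: slh_eq; apply/funext => a; exact: gpr.
Defined.

Lemma fn_mk a : fn mk_hom a = g a. Proof. by []. Qed.

End MakeHom.

(** It suffices to consider the preimages of the members of a finite cover of [B]
by clopen upsets on which the map to [X] is injective. *)
Lemma hom_of_family A B (g : car A -> car B) (I : finType)
    (W : I -> set (car B)) :
  (forall a, pr (g a) = pr a) -> (forall b, exists i, W i b) ->
  (forall i b b', W i b -> W i b' -> pr b = pr b' -> b = b') ->
  (forall i, cu (W i)) -> (forall i, cu (g @^-1` (W i))) ->
  exists u : Hom A B, forall a, fn u a = g a.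
Proof.
move=> gpr covW injW cW gW.
suff gcu S : cu S -> cu (g @^-1` S) by exists (mk_hom gpr gcu).
move=> cS; have -> : g @^-1` S =
    [set a | exists i, (g @^-1` (W i) `&` @pr A @^-1` (@pr B @` (S `&` W i))) a].
  apply/seteqP; split=> a /=.
    move=> Sa; have [i Wa] := covW (g a); exists i; split=> //.
    by exists (g a); rewrite // gpr.
  move=> [i [Wa [b [Sb Wb] ba]]]; rewrite /preimage /= -(injW _ _ _ Wb Wa) //.
  by rewrite gpr.
by apply: cu_exists => i; apply: cuI; [exact: gW|apply/pr_cu/pr_im/cuI].
Qed.

Lemma hom_ch A B (g : car A -> car B) :
  (forall a, pr (g a) = pr a) -> (forall i : ix B, cu (g @^-1` (ch i))) ->
  exists u : Hom A B, forall a, fn u a = g a.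
Proof.
move=> gpr gW; apply: (hom_of_family gpr (@ch_cov B) _ _ gW).
  exact: ch_inj.
exact: ch_cu.
Qed.

(** The base itself, as an object over itself. *)
Definition term_ob : EsaEt X := @SliceOb EsaSlh X X (slh_id X).

Lemma term_is_terminal : is_terminal term_ob.
Proof.
move=> A; have gcu S : cu S -> cu (@pr A @^-1` S) by exact: pr_cu.
exists (@mk_hom A term_ob (@pr A) (fun=> erefl) gcu); split=> // u _.
by apply: hom_ext => a; rewrite fn_mk -(fn_pr u a).
Qed.

End Objects.

(** * Pullbacks, products and monomorphisms *)

Section Pullbacks.
Variable X : esakia_space.
Implicit Types A B D P Q : EsaEt X.

Section Construction.
Variables (A B D : EsaEt X) (u : Hom A D) (v : Hom B D).

(** The fibre product of the underlying sets. *)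
Definition fibred : Type := {ab : car A * car B | fn u ab.1 = fn v ab.2}.

Definition fibred_pr (z : fibred) : X := pr (sval z).1.

Lemma fibred_prE (z : fibred) : fibred_pr z = pr (sval z).2.
Proof. by rewrite /fibred_pr -(fn_pr u) (svalP z) fn_pr. Qed.

Lemma fibred_cu (S : set (car A)) (T : set (car B)) : cu S -> cu T ->
  cu (fibred_pr @` [set z | S (sval z).1 /\ T (sval z).2]).
Proof.
move=> cS cT.
have -> : fibred_pr @` [set z | S (sval z).1 /\ T (sval z).2] = [set x |
    exists k, (@pr _ A @` (S `&` fn u @^-1` ch k) `&`
               @pr _ B @` (T `&` fn v @^-1` ch k)) x].
  apply/seteqP; split=> x.
    move=> [z [Sz Tz] <-]; have [k Dk] := ch_cov (fn u (sval z).1).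
    exists k; split; first by exists (sval z).1.
    rewrite fibred_prE; exists (sval z).2 => //; split=> //.
    by rewrite /preimage /= -(svalP z).
  move=> [k [[a [Sa ka] <-] [b [Tb kb] ba]]].
  have uv : fn u (a, b).1 = fn v (a, b).2.
    by apply: (ch_inj ka kb); rewrite !fn_pr.
  by exists (exist _ (a, b) uv).
by apply: cu_exists => k; apply: cuI; apply/pr_im/cuI => //; apply/fn_cu/ch_cu.
Qed.

(** Fibre products of charts. *)
Definition fibred_ch (ij : ix A * ix B) : set fibred :=
  [set z | ch ij.1 (sval z).1 /\ ch ij.2 (sval z).2].

Lemma fibred_eq (z z' : fibred) :
  (sval z).1 = (sval z').1 -> (sval z).2 = (sval z').2 -> z = z'.
Proof.
case: z z' => [[a b] e] [[a' b'] e'] /= aa' bb'.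
by subst a' b'; congr exist; exact: Prop_irrelevance.
Qed.

Lemma fibred_atlas : atlas fibred_pr fibred_ch.
Proof.
split.
- move=> [i j] z z' [/= iz jz] [/= iz' jz'] zz'; apply: fibred_eq.
    exact: (ch_inj iz iz').
  by apply: (ch_inj jz jz'); rewrite -!fibred_prE.
- move=> z; have [i iz] := ch_cov (sval z).1; have [j jz] := ch_cov (sval z).2.
  by exists (i, j).
- move=> [i j] [i' j'].
  have -> : fibred_ch (i, j) `&` fibred_ch (i', j') =
      [set z | (ch i `&` ch i') (sval z).1 /\ (ch j `&` ch j') (sval z).2].
    by apply/seteqP; split=> z /=; [move=> [[? ?] [? ?]]|move=> [[? ?] [? ?]]].
  by apply: fibred_cu; apply: cuI; exact: ch_cu.
Qed.

Definition fibred_ob : EsaEt X := total_ob fibred_atlas.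

Lemma fibred_ob_cu (S : set (car A)) (T : set (car B)) : cu S -> cu T ->
  cu ([set z | S (sval z).1 /\ T (sval z).2] : set (car fibred_ob)).
Proof.
move=> cS cT; apply/cu_total => -[i j].
have -> : [set z | S (sval z).1 /\ T (sval z).2] `&` fibred_ch (i, j) =
    [set z | (S `&` ch i) (sval z).1 /\ (T `&` ch j) (sval z).2].
  by apply/seteqP; split=> z /=; [move=> [[? ?] [? ?]]|move=> [[? ?] [? ?]]].
by apply: fibred_cu; apply: cuI => //; exact: ch_cu.
Qed.

Lemma fibred_fst : exists p : Hom fibred_ob A, forall z, fn p z = (sval z).1.
Proof.
apply: (@hom_ch X fibred_ob A (fun z : fibred => (sval z).1)) => // i.
have := fibred_ob_cu (ch_cu i) (@cuT _ (car B)).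
by congr cu; apply/seteqP; split=> z //= -[].
Qed.

Lemma fibred_snd : exists q : Hom fibred_ob B, forall z, fn q z = (sval z).2.
Proof.
apply: (@hom_ch X fibred_ob B (fun z : fibred => (sval z).2)).
  by move=> z; rewrite -fibred_prE.
move=> j; have := fibred_ob_cu (@cuT _ (car A)) (ch_cu j).
by congr cu; apply/seteqP; split=> z //= -[].
Qed.

End Construction.

(** The square is a pullback on underlying sets. *)
Definition pointwise_pullback A B D P (u : Hom A D) (v : Hom B D)
    (p : Hom P A) (q : Hom P B) : Prop :=
  [/\ forall z, fn u (fn p z) = fn v (fn q z),
      forall a b, fn u a = fn v b -> exists z, fn p z = a /\ fn q z = b &
      forall z z', fn p z = fn p z' -> fn q z = fn q z' -> z = z'].

Lemma pointwise_pullback_ex A B D (u : Hom A D) (v : Hom B D) :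
  exists P (p : Hom P A) (q : Hom P B), pointwise_pullback u v p q.
Proof.
have [p pE] := fibred_fst u v; have [q qE] := fibred_snd u v.
exists (fibred_ob u v), p, q; split.
- by move=> z; rewrite pE qE; exact: svalP z.
- move=> a b ab; pose z : fibred u v := exist _ (a, b) ab.
  by exists z; rewrite pE qE.
- by move=> z z'; rewrite !pE !qE; exact: fibred_eq.
Qed.

(** A function into [P] is a morphism if its composites with two jointly injective
morphisms are. *)
Lemma joint_hom A B P Q (p : Hom P A) (q : Hom P B)
    (p' : Hom Q A) (q' : Hom Q B) :
  (forall z z', fn p z = fn p z' -> fn q z = fn q z' -> z = z') ->
  (forall c, exists z, fn p z = fn p' c /\ fn q z = fn q' c) ->
  exists! w : Hom Q P, p \oc w = p' /\ q \oc w = q'.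
Proof.
move=> inj /choice [g gE].
have [|||||w wE] := @hom_of_family X Q P g (ix A * ix B)%type
    (fun ij => fn p @^-1` ch ij.1 `&` fn q @^-1` ch ij.2).
- by move=> c; rewrite -(fn_pr p) (gE c).1 fn_pr.
- move=> z; have [i iz] := ch_cov (fn p z); have [j jz] := ch_cov (fn q z).
  by exists (i, j).
- move=> [i j] z z' [/= iz jz] [/= iz' jz'] zz'; apply: inj.
    by apply: (ch_inj iz iz'); rewrite !fn_pr.
  by apply: (ch_inj jz jz'); rewrite !fn_pr.
- by move=> [i j]; apply: cuI; apply/fn_cu/ch_cu.
- move=> [i j]; have -> : g @^-1` (fn p @^-1` ch i `&` fn q @^-1` ch j) =
      fn p' @^-1` ch i `&` fn q' @^-1` ch j.
    by apply/seteqP; split=> c; rewrite /preimage /= (gE c).1 (gE c).2.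
  by apply: cuI; apply/fn_cu/ch_cu.
exists w; split.
  by split; apply: hom_ext => c; rewrite fn_comp wE; case: (gE c).
move=> w' [pw qw]; apply: hom_ext => c; rewrite wE; apply: inj.
  by rewrite (gE c).1 -pw.
by rewrite (gE c).2 -qw.
Qed.

Lemma pointwise_pullbackP A B D P (u : Hom A D) (v : Hom B D)
    (p : Hom P A) (q : Hom P B) :
  is_pullback u v p q <-> pointwise_pullback u v p q.
Proof.
split=> [[upvq univ]|[comm ex inj]]; last first.
  split; first by apply: hom_ext => z; exact: comm.
  move=> Q p' q' uvQ; apply: joint_hom => // c; apply: ex.
  by rewrite -!fn_comp uvQ.
(* P is isomorphic to the fibre product P0, where the claim is clear. *)
have [P0 [p0 [q0 [comm0 ex0 inj0]]]] := pointwise_pullback_ex u v.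
have e0 : u \oc p0 = v \oc q0 by apply: hom_ext => z; exact: comm0.
have [w [[pw qw] _]] := univ _ _ _ e0.
have comm z : fn u (fn p z) = fn v (fn q z) by rewrite -!fn_comp upvq.
have [w' [[pw' qw'] _]] : exists! w' : Hom P P0, p0 \oc w' = p /\ q0 \oc w' = q.
  by apply: joint_hom => // z; apply: ex0.
have ww' : w \oc w' = idm P.
  have [t [_ tU]] := univ _ _ _ upvq.
  rewrite -(tU (idm P)); last by split; apply: compm1.
  by symmetry; apply: tU; rewrite !compmA pw qw.
split=> //.
- move=> a b /ex0 [z [<- <-]]; exists (fn w z).
  by rewrite -!fn_comp pw qw.
- move=> z z' pz qz; have ww z1 : fn w (fn w' z1) = z1 by rewrite -fn_comp ww'.
  by rewrite -(ww z) -(ww z'); congr (fn w _); apply: inj0;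
    rewrite -!fn_comp ?pw' ?qw'.
Qed.

Lemma esaet_pullbacks : has_pullbacks (EsaEt X).
Proof.
move=> A B D u v; have [P [p [q pb]]] := pointwise_pullback_ex u v.
by exists P, p, q; exact/pointwise_pullbackP.
Qed.

Lemma monicP A B (m : Hom A B) : monic m <-> injective (fn m).
Proof.
split=> [mm a b mab|inj Q u v muv]; last first.
  by apply: hom_ext => c; apply: inj; rewrite -!fn_comp muv.
have [P [p [q [comm ex _]]]] := pointwise_pullback_ex m m.
have [z [<- <-]] := ex _ _ mab.
by congr (fn _ z); apply: mm; apply: hom_ext => w; exact: comm.
Qed.

(** Products in EsaEt(X) are fibre products over [X]. *)
Definition pointwise_product A B P (p : Hom P A) (q : Hom P B) : Prop :=
  (forall a b, pr a = pr b -> exists z, fn p z = a /\ fn q z = b) /\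
  (forall z z', fn p z = fn p z' -> fn q z = fn q z' -> z = z').

Lemma pointwise_productP A B P (p : Hom P A) (q : Hom P B) :
  is_product p q <-> pointwise_product p q.
Proof.
have [u [_ uU]] := @term_is_terminal X A; have [v [_ vU]] := @term_is_terminal X B.
have prE C (w : Hom C (term_ob X)) c : fn w c = pr c by rewrite -(fn_pr w).
have comm Q (p' : Hom Q A) (q' : Hom Q B) : u \oc p' = v \oc q'.
  by apply: hom_ext => c; rewrite !prE.
suff -> : is_product p q <-> is_pullback u v p q.
  rewrite pointwise_pullbackP; split=> [[_ ex inj]|[ex inj]]; split=> //.
  - by move=> a b ab; apply: ex; rewrite !prE.
  - by move=> z; rewrite !prE !fn_pr.
  - by move=> a b; rewrite !prE; exact: ex.
split=> [univ|[_ univ]]; first by split=> // Q p' q' _; exact: univ.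
by move=> Q p' q'; exact: univ.
Qed.

Lemma pointwise_product_ex A B :
  exists P (p : Hom P A) (q : Hom P B), pointwise_product p q.
Proof.
have [u _] := @term_is_terminal X A; have [v _] := @term_is_terminal X B.
have [P [p [q [_ ex inj]]]] := pointwise_pullback_ex u v.
exists P, p, q; split=> // a b ab; apply: ex.
by change (pr (fn u a) = pr (fn v b)); rewrite !fn_pr.
Qed.

End Pullbacks.

(** * Objects of germs *)

(** The trace of [S] on the principal upset of [x]; it represents the germ of [S]
at [x] for the spectral topology. *)
Definition up (X : esakia_space) (x : X) (S : set X) : set X :=
  [set y | x <= y /\ S y].

Lemma up_eq (X : esakia_space) (x : X) (S T : set X) :
  up x S = up x T <-> (forall y, x <= y -> (S y <-> T y)).
Proof.
split=> [ST y xy|ST].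
  have := congr1 (@^~ y) ST; rewrite /up /= => e.
  split=> [Sy|Ty]; first by have [] : x <= y /\ T y by rewrite -e.
  by have [] : x <= y /\ S y by rewrite e.
by apply/seteqP; split=> y [xy Hy]; split=> //; apply/(ST y xy).
Qed.

Lemma cu_iff (X : esakia_space) (S T : set X) : cu S -> cu T ->
  cu [set x | forall y, x <= y -> (S y <-> T y)].
Proof.
move=> cS cT; have -> : [set x | forall y, x <= y -> (S y <-> T y)] =
    [set x | forall y, x <= y -> S y -> T y] `&`
    [set x | forall y, x <= y -> T y -> S y].
  apply/seteqP; split=> x /= => [xST|[ST TS] y xy].
    by split=> y xy Sy; apply/(xST y xy).
  by split; [exact: ST|exact: TS].
by apply: cuI; apply: cu_imp => //; exact: esa_esakia.
Qed.

(** Finitely many clopen upsets [B j] that represent all germs of clopen upsets at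
all points. *)
Definition local_basis (X : esakia_space) (J : finType) (B : J -> set X) : Prop :=
  (forall j, cu (B j)) /\
  forall S, cu S -> forall x, exists j, forall y, x <= y -> (S y <-> B j y).

Section Germs.
Variables (X : esakia_space) (J : finType) (B : J -> set X).
Hypothesis basisB : local_basis B.
Variables (K : finType) (C : X -> (K -> set X) -> Prop).

(** The family of germs at [x] that is named by [phi]. *)
Definition basic_germ (phi : {ffun K -> J}) (x : X) : K -> set X :=
  fun k => up x (B (phi k)).

(** For every named family of germs, the points at which it satisfies [C] form a
clopen upset. *)
Hypothesis cuC : forall phi, cu [set x | C x (basic_germ phi x)].

(** Pairs of a point [x] and a [K]-indexed family of germs at [x] that satisfies
[C]. *)
Definition germ : Type := {z : X * (K -> set X) |
  C z.1 z.2 /\ exists phi, z.2 = basic_germ phi z.1}.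

Definition germ_pr (z : germ) : X := (sval z).1.

(** The chart of the points whose family of germs is named by [phi]. *)
Definition germ_ch (phi : {ffun K -> J}) : set germ :=
  [set z | (sval z).2 = basic_germ phi (sval z).1].

Lemma germ_eq (z z' : germ) :
  (sval z).1 = (sval z').1 -> (sval z).2 = (sval z').2 -> z = z'.
Proof.
case: z z' => [[a b] e] [[a' b'] e'] /= aa' bb'.
by subst a' b'; congr exist; exact: Prop_irrelevance.
Qed.

Lemma cu_basic_germ_eq (phi psi : {ffun K -> J}) :
  cu [set x | basic_germ phi x = basic_germ psi x].
Proof.
have [cB _] := basisB.
have -> : [set x | basic_germ phi x = basic_germ psi x] =
  [set x | forall k, [set x | forall y, x <= y -> (B (phi k) y <-> B (psi k) y)] x].
  apply/seteqP; split=> x /=.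
    by move=> e k; apply/up_eq; have := congr1 (@^~ k) e.
  by move=> e; apply/funext => k; apply/up_eq; exact: e.
by apply: cu_forall => k; exact: cu_iff.
Qed.

Lemma germ_atlas : atlas germ_pr germ_ch.
Proof.
split.
- move=> phi z z' zphi z'phi zz'; apply: (germ_eq zz').
  by rewrite zphi z'phi -[(sval z).1]/(germ_pr z) zz'.
- by move=> z; have [_ [phi zphi]] := svalP z; exists phi.
- move=> phi psi; have -> : germ_pr @` (germ_ch phi `&` germ_ch psi) =
      [set x | C x (basic_germ phi x)] `&`
      [set x | basic_germ phi x = basic_germ psi x].
    apply/seteqP; split=> x.
      move=> [z [zphi zpsi] <-]; split=> /=; last by rewrite -zphi -zpsi.
      by rewrite -zphi; case: (svalP z).
    move=> [/= Cx e].
    by exists (exist _ (x, basic_germ phi x) (conj Cx (ex_intro _ phi erefl))).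
  by apply: cuI; [exact: cuC|exact: cu_basic_germ_eq].
Qed.

Definition germ_ob : EsaEt X := total_ob germ_atlas.

(** The family of germs of a point, each germ being a subset of the principal upset
of the base point; [germ_mem k] is the universal [k]-th clopen upset, consisting of
the points whose base point belongs to their [k]-th germ. *)
Definition germ_set (z : car germ_ob) : K -> set X := (sval (z : germ)).2.

Definition germ_mem (k : K) : set (car germ_ob) := [set z | germ_set z k (pr z)].

Lemma germ_set_eq (z z' : car germ_ob) : pr z = pr z' ->
  germ_set z = germ_set z' -> z = z'.
Proof. exact: germ_eq. Qed.

Lemma germ_cond (z : car germ_ob) : C (pr z) (germ_set z).
Proof. by case: (svalP (z : germ)). Qed.

Lemma germ_ch_cu phi : cu (germ_ch phi : set (car germ_ob)).
Proof. by apply/cu_total; exact: (definableV germ_atlas). Qed.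

Lemma germ_mem_cu k : cu (germ_mem k).
Proof.
have [cB _] := basisB.
apply/cu_total => phi; have -> : germ_pr @` (germ_mem k `&` germ_ch phi) =
    germ_pr @` (germ_ch phi `&` germ_ch phi) `&` B (phi k).
  apply/seteqP; split=> x.
    move=> [z [zk zphi] <-]; split; first by exists z.
    by move: zk; rewrite /germ_mem /germ_set /= zphi => -[].
  move=> [[z [zphi _] <-] Bz]; exists z => //; split=> //.
  by rewrite /germ_mem /germ_set /= zphi; split.
by apply: cuI => //; exact: (definableV germ_atlas).
Qed.

Lemma germ_set_pr (z : car germ_ob) k x : germ_set z k x -> pr z <= x.
Proof.
by have [_ [phi zphi]] := svalP (z : germ); rewrite /germ_set zphi => -[].
Qed.

(** The germs of a point are determined by the membership of the points above it in
the universal clopen upsets. *)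
Lemma germ_set_le (z z' : car germ_ob) k : z <= z' ->
  (germ_set z k (pr z') <-> germ_mem k z').
Proof.
move=> zz'; have [_ [phi zphi]] := svalP (z : germ).
have z'phi : germ_ch phi z' by apply: cu_up zz' zphi; exact: germ_ch_cu.
rewrite /germ_mem /germ_set /= zphi z'phi.
have pzz' := pr_le zz'; split=> -[_ Bz]; by split.
Qed.

Lemma germ_set_up (z : car germ_ob) k x y :
  germ_set z k x -> x <= y -> germ_set z k y.
Proof.
have [cB _] := basisB; have [_ [phi zphi]] := svalP (z : germ).
rewrite /germ_set zphi => -[zx Bx] xy; split; first exact: le_trans xy.
by have [_ uB] := cB (phi k); exact: uB Bx.
Qed.

(** Morphisms from [A] to the object of germs correspond to [K]-indexed families of
clopen upsets of [A]: injectivity, and existence ([germ_hom_ex]). *)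
Lemma germ_hom_ext (A : EsaEt X) (g h : Hom A germ_ob) :
  (forall k a, germ_mem k (fn g a) <-> germ_mem k (fn h a)) -> g = h.
Proof.
move=> gh; apply: hom_ext => a; apply: germ_set_eq; first by rewrite !fn_pr.
suff sub (g1 h1 : Hom A germ_ob) : (forall k a, germ_mem k (fn g1 a) ->
    germ_mem k (fn h1 a)) ->
    forall k, germ_set (fn g1 a) k `<=` germ_set (fn h1 a) k.
  by apply/funext => k; apply/seteqP; split; apply: sub => k' b /gh.
move=> g1h1 k x gx; have := germ_set_pr gx; rewrite fn_pr => ax.
have [b ab bx] := lift_ex ax.
have e1 : pr (fn g1 b) = x by rewrite fn_pr.
have e2 : pr (fn h1 b) = x by rewrite fn_pr.
rewrite -e2; apply/(germ_set_le k (fn_le h1 ab)); apply: g1h1.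
by apply/(germ_set_le k (fn_le g1 ab)); rewrite e1.
Qed.

(** The germs at [pr a] of a family of subsets of [A], read along the lifts of the
points above [pr a]. *)
Definition trace (A : EsaEt X) (T : K -> set (car A)) (a : car A) : K -> set X :=
  fun k => [set x | exists b, [/\ a <= b, pr b = x & T k b]].

Lemma trace_ch (A : EsaEt X) (T : K -> set (car A)) a (i : ix A) k :
  ch i a -> trace T a k = up (pr a) (@pr X A @` (T k `&` ch i)).
Proof.
move=> ia; apply/seteqP; split=> x.
  move=> [b [ab <- Tb]]; split; first exact: pr_le.
  by exists b => //; split=> //; apply: cu_up ab ia; exact: ch_cu.
move=> [ax [b [Tb ib] bx]]; have [c [ac cx ic]] := ch_lift ia ax.
by exists b; split=> //; rewrite (ch_inj ib ic) // bx.
Qed.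

Lemma germ_hom_ex (A : EsaEt X) (T : K -> set (car A)) :
  (forall k, cu (T k)) -> (forall a, C (pr a) (trace T a)) ->
  exists g : Hom A germ_ob, forall k a, germ_mem k (fn g a) <-> T k a.
Proof.
move=> cT CT; have [cB Bloc] := basisB.
have germT a : exists phi, trace T a = basic_germ phi (pr a).
  have [i ia] := ch_cov a.
  have /fin_all_exists [phi phiP] k := Bloc _ (im_setI_ch i (cT k)) (pr a).
  exists [ffun k => phi k]; apply/funext => k.
  by rewrite (trace_ch _ _ ia) /basic_germ ffunE; apply/up_eq; exact: phiP.
pose g (a : car A) : car germ_ob :=
  exist _ (pr a, trace T a) (conj (CT a) (germT a)) : germ.
have [|||||u uE] := @hom_of_family X A germ_ob g _ germ_ch.
- by [].
- by have [] := germ_atlas.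
- by have [] := germ_atlas.
- exact: germ_ch_cu.
- move=> phi; apply: cu_ch => i.
  have -> : @pr X A @` (g @^-1` germ_ch phi `&` ch i) = @pr X A @` ch i `&`
    [set x | forall k, [set x | forall y, x <= y ->
      ((@pr X A @` (T k `&` ch i)) y <-> B (phi k) y)] x].
    apply/seteqP; split=> x.
      move=> [a [ga ia] <-]; split; first by exists a.
      move=> k; apply/up_eq; rewrite -trace_ch //.
      by have := congr1 (@^~ k) ga.
    move=> [[a ia <-] e]; exists a => //; split=> //.
    by apply/funext => k; rewrite /= (trace_ch _ _ ia); apply/up_eq; exact: e.
  apply: cuI; first exact/pr_im/ch_cu.
  by apply: cu_forall => k; apply: cu_iff => //; exact: im_setI_ch.
exists u => k a; rewrite uE /germ_mem /germ_set /=; split.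
  move=> [b [ab ba Tb]].
  by rewrite (lift_uniq (lexx a) ab (esym ba)).
by move=> Ta; exists a.
Qed.

End Germs.

(** * Subobject classifier and exponentials *)

Section Classifier.
Variables (X : esakia_space) (J : finType) (B : J -> set X).
Hypothesis basisB : local_basis B.

Let cuTrue (phi : {ffun unit -> J}) : cu [set x : X | True].
Proof. exact: cuT. Qed.

(** The points over [x] are the germs of clopen upsets at [x]. *)
Definition omega : EsaEt X :=
  @germ_ob X J B basisB unit (fun _ _ => True) cuTrue.

Lemma omega_true_eq (z z' : car omega) :
  germ_mem tt z -> germ_mem tt z' -> pr z = pr z' -> z = z'.
Proof.
move=> zt z't zz'; apply: germ_set_eq => //; apply/funext => -[].
have setE (w : car omega) : germ_mem tt w -> germ_set w tt = [set x | pr w <= x].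
  move=> wt; apply/seteqP; split=> x; first exact: germ_set_pr.
  by move=> wx; exact: germ_set_up wt wx.
by rewrite !setE // zz'.
Qed.

(** The characteristic map of a monomorphism [m] is the one that corresponds to
the image of [m]. *)
Lemma esaet_classifier :
  exists T E (t : Hom T E), @is_subobject_classifier (EsaEt X) T E t.
Proof.
have [|//|t tE] := @germ_hom_ex X J B basisB unit (fun _ _ => True) cuTrue
  (term_ob X) (fun=> setT); first by move=> _; exact: cuT.
exists (term_ob X), omega, t; split; first exact: term_is_terminal.
have tmem x : germ_mem tt (fn t x) by apply/tE.
have prT (x : car (term_ob X)) : pr x = x by [].
move=> A D m /monicP inj; have [u [_ _]] := @term_is_terminal X A.
have [|//|chi chiE] := @germ_hom_ex X J B basisB unit (fun _ _ => True) cuTrue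
  D (fun=> fn m @` setT); first by move=> _; apply: fn_im; exact: cuT.
exists chi; split.
  exists u; apply/pointwise_pullbackP; split.
  - move=> a; apply: omega_true_eq => //; last by rewrite !fn_pr.
    by apply/chiE; exists a.
  - move=> d x dx; have /chiE [a _ ad] : germ_mem tt (fn chi d) by rewrite dx.
    exists a; split=> //; rewrite -(prT (fn u a)) fn_pr -(fn_pr m) ad.
    by rewrite -(fn_pr chi) dx fn_pr.
  - by move=> a a' /inj.
move=> chi' [u' /pointwise_pullbackP [comm ex _]].
apply: germ_hom_ext => -[] d; rewrite chiE; split.
  by move=> [a _ <-]; rewrite comm.
move=> dt; have [|a [ad _]] := ex d (pr d); last by exists a.
by apply: omega_true_eq => //; rewrite !fn_pr.
Qed.

End Classifier.

Section Exponentials.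
Variables (X : esakia_space) (J : finType) (B : J -> set X).
Hypothesis basisB : local_basis B.
Variables A D : EsaEt X.

Let K : finType := (ix A * ix D)%type.

(** Part of [X] over which the charts [i] and [i'] coincide; for [i = i'], the image
of the chart. *)
Let dom (E : EsaEt X) (i i' : ix E) : set X := @pr X E @` (ch i `&` ch i').

Let cu_dom (E : EsaEt X) (i i' : ix E) : cu (dom i i').
Proof. by apply: im_setI_ch; exact: ch_cu. Qed.

(** A family of germs, indexed by pairs of charts, describes a germ of map from [A]
to [D] when [S (i, j)] is the set of points over which the map sends the point of
chart [i] to the point of chart [j]. The conditions say that [S (i, j)] lies where
both charts are defined, that [S] does not depend on the charts chosen to name the
points, that it is single-valued, and that it is total. *)
Definition graph_germ (x : X) (S : K -> set X) : Prop :=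
  [/\ forall i j y, x <= y -> S (i, j) y -> (dom i i `&` dom j j) y,
      forall i i' j j' y, x <= y ->
        (S (i, j) `&` (dom i i' `&` dom j j')) y -> S (i', j') y,
      forall i j j' y, x <= y -> (S (i, j) `&` S (i, j')) y -> dom j j' y &
      forall i y, x <= y -> dom i i y -> exists j, S (i, j) y].

Let cu_graph (phi : {ffun K -> J}) :
  cu [set x | graph_germ x (basic_germ B phi x)].
Proof.
have [cB _] := basisB; have eX := esa_esakia X.
have -> : [set x | graph_germ x (basic_germ B phi x)] =
  [set x | forall i j y, x <= y -> B (phi (i, j)) y -> (dom i i `&` dom j j) y] `&`
  [set x | forall i i' j j' y, x <= y ->
    (B (phi (i, j)) `&` (dom i i' `&` dom j j')) y -> B (phi (i', j')) y] `&`
  [set x | forall i j j' y, x <= y ->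
    (B (phi (i, j)) `&` B (phi (i, j'))) y -> dom j j' y] `&`
  [set x | forall i y, x <= y -> dom i i y ->
    [set y | exists j, B (phi (i, j)) y] y].
  apply/seteqP; split=> x.
    move=> [c1 c2 c3 c4]; do 3?split.
    - by move=> i j y xy By; apply: c1.
    - move=> i i' j j' y xy [By dy].
      by have [] := c2 i i' j j' y xy (conj (conj xy By) dy).
    - by move=> i j j' y xy [By By']; apply: (c3 i j j' y xy).
    - by move=> i y xy dy; have [j [_ By]] := c4 i y xy dy; exists j.
  move=> [[[c1 c2] c3] c4]; split.
  - by move=> i j y xy [_ By]; apply: c1 By.
  - move=> i i' j j' y xy [[_ By] dy]; split=> //.
    exact: (c2 i i' j j' y xy (conj By dy)).
  - by move=> i j j' y xy [[_ By] [_ By']]; apply: (c3 i j j' y xy).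
  - by move=> i y xy dy; have [j By] := c4 i y xy dy; exists j.
apply: cuI; first apply: cuI; first apply: cuI.
- do 2![apply: cu_forall => ?]; apply: cu_imp => //.
  exact: cuI.
- do 4![apply: cu_forall => ?]; apply: cu_imp => //.
  by apply: cuI => //; exact: cuI.
- do 3![apply: cu_forall => ?]; apply: cu_imp => //.
  exact: cuI.
- apply: cu_forall => i; apply: cu_imp => //.
  by apply: cu_exists => j.
Qed.

(** The exponential of [D] by [A]. *)
Definition exp_ob : EsaEt X := germ_ob basisB cu_graph.

Implicit Types (z : car exp_ob) (a : car A) (b : car D).

(** The germ of map [z] sends [a] to [b], where [a] lies over the base point
of [z]. *)
Definition applies z a b : Prop :=
  exists i j, [/\ ch i a, ch j b, pr b = pr a & germ_mem (i, j) z].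

Lemma applies_ex z a : pr z = pr a -> exists b, applies z a b.
Proof.
move=> za; have [c1 _ _ c4] := germ_cond z.
have [i ia] := ch_cov a.
have [|j Sz] := c4 i (pr z) (lexx _); first by exists a.
have [_ [b [jb _] bz]] := c1 i j _ (lexx _) Sz.
by exists b, i, j; split=> //; rewrite bz.
Qed.

Lemma applies_mem z a b i j : pr z = pr a -> applies z a b ->
  ch i a -> ch j b -> germ_mem (i, j) z.
Proof.
move=> za [i' [j' [i'a j'b ba Sz]]] ia jb.
have [_ c2 _ _] := germ_cond z.
apply: (c2 i' i j' j _ (lexx _)); split=> //; split.
  by exists a.
by exists b; rewrite // ba.
Qed.

Lemma applies_uniq z a b b' : pr z = pr a ->
  applies z a b -> applies z a b' -> b = b'.
Proof.
move=> za ab ab'; have [_ _ c3 _] := germ_cond z.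
have [i [j [ia jb ba Sb]]] := ab; have [i' [j' [ia' jb' ba' Sb']]] := ab'.
have Sij' := applies_mem za ab' ia jb'.
have [c [jc jc'] cz] := c3 i j j' _ (lexx _) (conj Sb Sij').
have <- : c = b by apply: (ch_inj jc jb); rewrite cz za ba.
by apply: (ch_inj jc' jb'); rewrite cz za ba'.
Qed.

Lemma eval_ex (P : EsaEt X) (p : Hom P exp_ob) (q : Hom P A) :
  exists ev : Hom P D, forall w, applies (fn p w) (fn q w) (fn ev w).
Proof.
have pq w : pr (fn p w) = pr (fn q w) by rewrite !fn_pr.
have /choice [g gP] w := applies_ex (pq w).
have [||u uE] := @hom_ch X P D g.
- by move=> w; have [i [j [_ _ -> _]]] := gP w; rewrite fn_pr.
- move=> j; have -> : g @^-1` ch j =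
      [set w | exists i, (fn q @^-1` ch i `&` fn p @^-1` germ_mem (i, j)) w].
    apply/seteqP; split=> w.
      move=> jw; have [i iw] := ch_cov (fn q w); exists i; split=> //.
      exact: applies_mem (pq w) (gP w) iw jw.
    move=> [i [iw Sw]]; have [c1 _ _ _] := germ_cond (fn p w).
    have [_ [b [jb _] bw]] := c1 i j _ (lexx _) Sw.
    rewrite /preimage /= -(applies_uniq (b := b) (pq w) _ (gP w)) //.
    by exists i, j; split=> //; rewrite bw.
  apply: cu_exists => i; apply: cuI; apply: fn_cu; first exact: ch_cu.
  exact: germ_mem_cu.
- by exists u => w; rewrite uE.
Qed.

Lemma esaet_exponential :
  exists E P (p : Hom P E) (q : Hom P A) (ev : Hom P D), is_exponential p q ev.
Proof.
have [P [p [q pq]]] := pointwise_product_ex exp_ob A.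
have [ev evP] := eval_ex p q.
have prodP : is_product p q by exact/pointwise_productP.
exists exp_ob, P, p, q, ev; split=> // Y Q r s /pointwise_productP [exQ injQ] f.
have rs w : pr (fn r w) = pr (fn s w) by rewrite !fn_pr.
(* The k-th clopen upset of Y that names the transpose of f. *)
pose T (k : K) : set (car Y) :=
  fn r @` (fn s @^-1` ch k.1 `&` fn f @^-1` ch k.2).
have cT k : cu (T k) by apply: fn_im; apply: cuI; apply/fn_cu/ch_cu.
have trT y : graph_germ (pr y) (trace T y).
  split.
  - move=> i j _ _ [_ [_ <- [w [/= iw jw] <-]]].
    split; [exists (fn s w)|exists (fn f w)] => //; by rewrite !fn_pr.
  - move=> i i' j j' _ _ [[y' [yy' <- [w [/= iw jw] wy']]]
                         [[a [ia i'a] ay] [b [jb j'b] bY]]].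
    exists y'; split=> //; exists w => //; split; rewrite /preimage /=.
      by rewrite (ch_inj iw ia) // ay -wy' !fn_pr.
    by rewrite (ch_inj jw jb) // bY -wy' !fn_pr.
  - move=> i j j' _ _ [[y1 [yy1 <- [w1 [/= iw1 jw1] wy1]]]
                      [y2 [yy2 y21 [w2 [/= iw2 jw2] wy2]]]].
    have y12 : y1 = y2 by apply: lift_uniq yy1 yy2 _.
    have w12 : w1 = w2.
      apply: injQ; first by rewrite wy1 wy2.
      by apply: (ch_inj iw1 iw2); rewrite -!rs wy1 wy2 y12.
    by exists (fn f w1); [split=> //; rewrite w12|rewrite -wy1 !fn_pr].
  - move=> i x yx [a [ia _] ax]; have [y' yy' y'x] := lift_ex yx.
    have [|w [wy' wa]] := exQ y' a; first by rewrite ax.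
    have [j jw] := ch_cov (fn f w).
    by exists j, y'; split=> //; exists w => //; split=> //; rewrite /preimage /= wa.
have [g gT] := germ_hom_ex basisB cu_graph cT trT.
have [h [[ph qh] _]] := prodP Q (g \oc r) s.
have happ (g' : Hom Y exp_ob) (h' : Hom Q P) w :
    p \oc h' = g' \oc r -> q \oc h' = s ->
    applies (fn g' (fn r w)) (fn s w) (fn ev (fn h' w)).
  by move=> ph' qh'; have := evP (fn h' w); rewrite -!fn_comp ph' qh'.
have prg (g' : Hom Y exp_ob) w : pr (fn g' (fn r w)) = pr (fn s w).
  by rewrite !fn_pr.
exists g; split.
  exists h; split=> //; apply: hom_ext => w; rewrite fn_comp.
  apply: applies_uniq (prg g w) (happ _ _ _ ph qh) _.
  have [i iw] := ch_cov (fn s w); have [j jw] := ch_cov (fn f w).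
  by exists i, j; split=> //; [rewrite !fn_pr|apply/gT; exists w].
move=> g' [h' [ph' qh' evh']]; apply: germ_hom_ext => -[i j] y.
rewrite gT; split.
  move=> [w [/= iw jw] <-]; apply: applies_mem (prg g' w) (happ _ _ w ph' qh') iw _.
  by rewrite -fn_comp evh'.
move=> Sy; have [c1 _ _ _] := germ_cond (fn g' y).
have [[a [ia _] ay] [b [jb _] bY]] := c1 i j _ (lexx _) Sy.
have [|w [wy wa]] := exQ y a; first by rewrite ay fn_pr.
exists w => //; split; rewrite /preimage /=; first by rewrite wa.
rewrite -evh' fn_comp -(applies_uniq (b := b) (prg g' w) _ (happ _ _ w ph' qh')) //.
by exists i, j; split; rewrite ?wa ?wy // bY ay.
Qed.

End Exponentials.

Lemma esaet_topos (X : esakia_space) (J : finType) (B : J -> set X) :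
  local_basis B -> elementary_topos (EsaEt X).
Proof.
move=> basisB; split.
- by exists (term_ob X); exact: term_is_terminal.
- exact: esaet_pullbacks.
- by move=> A D; exact: (esaet_exponential basisB).
- exact: (esaet_classifier basisB).
Qed.

(** * Subobjects are clopen upsets *)

Section Subobjects.
Variables (X : esakia_space) (A : EsaEt X).
Implicit Types m n : mono_into A.

Definition mono_range m : set (car A) := range (fn (mono_arrow m)).

Lemma mono_range_cu m : cu (mono_range m).
Proof. by apply: fn_im; exact: cuT. Qed.

Lemma mono_leP m n : mono_le m n <-> mono_range m `<=` mono_range n.
Proof.
split=> [[h mh] _ [c _ <-]|mn]; first by exists (fn h c); rewrite // -mh.
have inj := (monicP _).1 (@mono_monic _ _ n).
have /choice [g gE] c : exists d, fn (mono_arrow n) d = fn (mono_arrow m) c.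
  by have [|d _ dc] := mn (fn (mono_arrow m) c); [exists c|exists d].
have [c|i|h hE] := @hom_ch X _ _ g; last first.
- by exists h; apply: hom_ext => c; rewrite fn_comp hE gE.
- have -> : g @^-1` ch i = fn (mono_arrow m) @^-1` (fn (mono_arrow n) @` ch i).
    apply/seteqP; split=> c.
      by move=> ic; exists (g c); rewrite // gE.
    by move=> [d id dc]; rewrite /preimage /= -(inj _ _ (etrans dc (esym (gE c)))).
  by apply/fn_cu/fn_im/ch_cu.
- by rewrite -(fn_pr (mono_arrow n)) gE fn_pr.
Qed.

Section OfSet.
Variables (S : set (car A)) (cS : cu S).

Definition sub_pr (z : {a | S a}) : X := pr (sval z).

Definition sub_ch (i : ix A) : set {a | S a} := [set z | ch i (sval z)].

Lemma sub_im (U : set (car A)) : cu U -> cu (sub_pr @` [set z | U (sval z)]).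
Proof.
move=> cU; have -> : sub_pr @` [set z | U (sval z)] = @pr X A @` (U `&` S).
  apply/seteqP; split=> x; first by move=> [[a Sa] Ua <-]; exists a.
  by move=> [a [Ua Sa] <-]; exists (exist _ a Sa).
by apply: pr_im; exact: cuI.
Qed.

Lemma sub_atlas : atlas sub_pr sub_ch.
Proof.
split.
- move=> i [a Sa] [b Sb] ia ib ab.
  have e : a = b by exact: ch_inj ia ib ab.
  by subst b; congr exist; exact: Prop_irrelevance.
- by move=> z; have [i iz] := ch_cov (sval z); exists i.
- by move=> i j; exact: (sub_im (cuI (ch_cu i) (ch_cu j))).
Qed.

Lemma sub_mono_ex : exists m, mono_range m = S.
Proof.
have [//|i|u uE] := @hom_ch X (total_ob sub_atlas) A (fun z : {a | S a} => sval z).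
  by apply/cu_total => j; exact: (sub_im (cuI (ch_cu i) (ch_cu j))).
have inj : monic u.
  apply/monicP => -[a Sa] [b Sb]; rewrite !uE /= => e; subst b.
  by congr exist; exact: Prop_irrelevance.
exists (MonoInto inj); apply/seteqP; split=> a.
  by move=> [z _ <-]; rewrite uE; exact: svalP z.
by move=> Sa; exists (exist _ a Sa : car (total_ob sub_atlas)); rewrite //= uE.
Qed.

Lemma sub_of_subproof : exists m,
  (fun n => mono_range n = S) = (fun n => mono_le m n /\ mono_le n m).
Proof.
have [m mS] := sub_mono_ex; exists m; apply/funext => n; apply/propext.
rewrite !mono_leP mS /=; split=> [->|[Sn nS]]; first by split.
exact/seteqP.
Qed.

(** The subobject of [A] given by the clopen upset [S]: all the monomorphisms with
image [S]. *)
Definition sub_of : subobject A := Subobject sub_of_subproof.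

Lemma sub_ofE n : sub_of n <-> mono_range n = S.
Proof. by []. Qed.

End OfSet.

Lemma sub_le_of (S T : set (car A)) (cS : cu S) (cT : cu T) :
  sub_le (sub_of cS) (sub_of cT) <-> S `<=` T.
Proof.
split=> [ST|ST m n mS nT]; last by apply/mono_leP; rewrite mS nT.
have [m mS] := sub_mono_ex cS; have [n nT] := sub_mono_ex cT.
by rewrite -mS -nT; apply/mono_leP; exact: ST.
Qed.

Lemma subobject_ext (s t : subobject A) : (forall n, s n <-> t n) -> s = t.
Proof.
case: s t => [s sP] [t tP] /= st.
have e : s = t by apply/funext => n; apply/propext; exact: st.
by clear st; subst t; rewrite (Prop_irrelevance sP tP).
Qed.

Lemma sub_of_ex (s : subobject A) : exists S (cS : cu S), s = sub_of cS.
Proof.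
have [m mE] := sub_classP s.
exists (mono_range m), (mono_range_cu m); apply: subobject_ext => n.
rewrite mE sub_ofE !mono_leP.
by split=> [[mn nm]|->]; [exact/seteqP|split].
Qed.

Lemma terminal_pr : is_terminal A -> bijective (@pr X A).
Proof.
move=> tA; have [w [_ _]] := tA (term_ob X).
have [v [_ vU]] := tA A.
have [u [_ _]] := @term_is_terminal X A.
have prE a : fn u a = pr a by rewrite -(fn_pr u).
exists (fn w) => [a|x]; last exact: fn_pr w x.
by rewrite -prE -fn_comp -(vU (w \oc u)) // (vU (idm A)).
Qed.

End Subobjects.

(** An order isomorphism from a lattice is a lattice isomorphism. *)
Lemma order_iso_lattice_iso d (L : latticeType d) (P : Type)
    (le : P -> P -> Prop) (phi : L -> P) :
  (forall a b : L, a <= b <-> le (phi a) (phi b)) ->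
  (forall s, exists a, s = phi a) -> lattice_iso le phi.
Proof.
move=> leP surj; split=> //.
- have /choice [g gE] := surj; exists g => [a|s]; last by rewrite -gE.
  by apply/le_anti/andP; split; apply/leP; rewrite -gE; apply/leP.
- move=> a b; split; rewrite -?leP ?leIl ?leIr //.
  by move=> s; have [c ->] := surj s; rewrite -!leP lexI => -> ->.
- move=> a b; split; rewrite -?leP ?leUl ?leUr //.
  by move=> s; have [c ->] := surj s; rewrite -!leP leUx => -> ->.
Qed.

(** * The spectrum of a Heyting algebra *)

Section Spectrum.
Variables (d : Order.disp_t) (H : heytingType d).

Lemma spec_basic_cu (a : H) : cu (spec_basic a).
Proof. by split; [exact: spec_basic_clopen|exact: spec_basic_upset]. Qed.

Lemma spec_basic_le (a b : H) : spec_basic a `<=` spec_basic b <-> a <= b.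
Proof.
split=> [ab|ab F Fa]; last by have [[_ Fup _] _ _] := spec_prime F; exact: Fup Fa.
apply: contrapT => nab.
have filA : lattice_filter [set x : H | a <= x].
  split=> /= [|x y xy ax|x y ax ay]; first exact: lex1.
    exact: le_trans xy.
  by rewrite lexI ax.
have [G [pG AG nGb]] := prime_filter_extension filA nab.
by apply: nGb; apply: (ab (Spec pG)); apply: AG; exact: lexx.
Qed.

Lemma cu_spec (S : set (spec H)) : cu S -> exists a, S = spec_basic a.
Proof.
move=> cS; have [pX _] := @spec_esakia d H.
have near x : S x -> exists2 a, spec_basic a x & spec_basic a `<=` S.
  move=> Sx; suff [a ax aS] : exists2 a, spec_basic a x & ~` S `<=` ~` spec_basic a.
    by exists a => // y ay; apply: contrapT => /aS.
  have cptS : compact (~` S).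
    by apply: priestley_compact => //; rewrite closedC; exact: cu_open.
  apply: (compact_ind (P := fun B => exists2 a, spec_basic a x &
    B `<=` ~` spec_basic a) cptS).
  - by exists \top => //; rewrite spec_basic1.
  - move=> B C [a ax Ba] [b bx Cb]; exists (Order.meet a b).
      by rewrite -spec_basicI.
    by rewrite -spec_basicI setCI; exact: setUSS.
  - by move=> B C BC [a ax Ca]; exists a => // y /BC /Ca.
  - move=> y nSy; have /existsNP [a /not_implyP [xa nya]] :
        ~ (spec_set x `<=` spec_set y).
      by move=> xy; apply: nSy; have [_ uS] := cS; apply: uS Sx; apply/asboolP.
    exists (~` spec_basic a); last by exists a.
    apply: open_nbhs_nbhs; split=> //; rewrite openC.
    by case: (spec_basic_clopen a).
suff [a Sa aS] : exists2 a, S `<=` spec_basic a & spec_basic a `<=` S.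
  by exists a; apply/seteqP.
have cptS : compact S by apply: priestley_compact => //; case: cS => -[].
apply: (compact_ind (P := fun B => exists2 a, B `<=` spec_basic a &
  spec_basic a `<=` S) cptS).
- by exists \bot; rewrite spec_basic0.
- move=> B C [a Ba aS] [b Cb bS]; exists (Order.join a b); rewrite -spec_basicU.
    exact: setUSS.
  by rewrite subUset.
- by move=> B C BC [a Ca aS]; exists a => // y /BC /Ca.
- move=> x /near [a ax aS]; exists (spec_basic a); last by exists a.
  by apply: open_nbhs_nbhs; split=> //; case: (spec_basic_clopen a).
Qed.

Lemma prime_filter_join (F : set H) (I : finType) (a : I -> H) :
  prime_filter F -> F (\join_i a i) -> exists i, F (a i).
Proof.
move=> [_ nF0 FU]; elim/big_ind: _ => // [x y Fx Fy /FU [/Fx|/Fy] //|i _ Fi].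
by exists i.
Qed.

(** By Jibladze's law, a prime filter [x] contains [hiff s (f h)] for some [h];
then [s] and [f h] belong to the same prime filters above [x]. *)
Lemma jibladze_local_basis d0 (H0 : finHeytingType d0) (f : H0 -> H) :
  jibladze f -> @local_basis (esakia_spec H) H0 (fun h => spec_basic (f h)).
Proof.
move=> fJ; split=> [h|S /cu_spec [s ->] x]; first exact: spec_basic_cu.
have [h xh] : exists h, spec_set x (hiff s (f h)).
  apply: prime_filter_join (spec_prime x) _; rewrite fJ.
  by have [[]] := spec_prime x.
exists h => y /asboolP xy; have := xy _ xh.
have [[_ up meet] _ _] := spec_prime y => yh.
have mp a b : spec_set y (himp a b) -> spec_set y a -> spec_set y b.
  by move=> yab ya; apply: up (meet _ _ yab ya); rewrite himpP.
by split; apply: mp; apply: up yh; rewrite ?leIl ?leIr.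
Qed.

End Spectrum.

Theorem theorem5p25 (d : Order.disp_t) (H : heytingType d)
    (hH : etale_finite H) :
  elementary_topos (EsaEt (esakia_spec H)) /\
  forall T : EsaEt (esakia_spec H), is_terminal T ->
    exists phi : H -> subobject T, lattice_iso (@sub_le _ T) phi.
Proof.
case: hH => d0 [H0 [f [_ fJ]]]; split.
  exact: esaet_topos (jibladze_local_basis fJ).
move=> T /terminal_pr [g prK gK].
exists (fun a => sub_of (pr_cu T (spec_basic_cu a))).
apply: order_iso_lattice_iso => [a b|s].
  rewrite sub_le_of -spec_basic_le; split=> ab x; first exact: ab.
  by rewrite -(gK x); exact: ab.
have [S [cS ->]] := sub_of_ex s.
have [a aE] := cu_spec (pr_im cS); exists a.
have e : S = @pr _ T @^-1` spec_basic a.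
  rewrite -aE; apply/seteqP; split=> t; first by move=> St; exists t.
  by move=> [t' St' tt']; rewrite -(can_inj prK tt').
move: (pr_cu _ _) => c; rewrite -e in c *.
by congr sub_of; exact: Prop_irrelevance.
Qed.
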